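(* Let $n\ge 2$, $s\in(0,1)$, $p\in(1,\infty)$ and $m>sp$. Let $H\in C(\mathbb{R}^n\times\mathbb{R}^n)$ and suppose there exist constants $\theta,\theta_1>0$ such that $$\theta|\xi|^m-\theta_1\le H(x,\xi)\qquad\text{for all }x,\xi\in\mathbb{R}^n.$$ Let $D>0$ and let $u\in L^\infty(\overline{B}_2)\cap L^{p-1}_{sp}(\mathbb{R}^n)$ be a viscosity subsolution of $$(-\Delta_p)^s u+H(x,\nabla u)\le D\qquad\text{in }B_2 .$$ Then $u$ is $\gamma$-H\''older continuous in $B_1$, and $\|u\|_{C^{0,\gamma}(\overline{B}_1)}$ is bounded by a constant depending only on $D,A,\theta,\theta_1,s,p,n,m$ and $\gamma$, where $$A=\sup_{B_2}|u|+\mathrm{Tail}_{s,p}(u;0,2)$$ and $$\gamma=\begin{cases}\dfrac{m-sp}{m-(p-1)} & \text{if } sp>p-1,\\[6pt] \text{any value in }(0,1) & \text{if either } sp=p-1 \text{ or } sp<m\le p-1,\\[4pt] 1 & \text{if } sp<p-1<m.\end{cases}$$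
   Context: $B_r$ denotes the open ball of radius $r$ centered at the origin of $\mathbb{R}^n$, and $B_r(x_0)$ the ball centered at $x_0$. A $1$-H\''older continuous function means a Lipschitz function. The fractional $p$-Laplacian is $$(-\Delta_p)^s u(x)=\mathrm{PV}\int_{\mathbb{R}^n}|u(x)-u(x+z)|^{p-2}(u(x)-u(x+z))\frac{dz}{|z|^{n+sp}}.$$ Tail space: $L^{p-1}_{sp}(\mathbb{R}^n)=\{g\in L^{p-1}_{\rm loc}(\mathbb{R}^n):\int_{\mathbb{R}^n}\frac{|g(z)|^{p-1}}{(1+|z|)^{n+sp}}dz<\infty\}$. Tail: $\mathrm{Tail}_{s,p}(g;x,r)=\Big(r^{sp}\int_{|z-x|\ge r}\frac{|g(z)|^{p-1}}{|z-x|^{n+sp}}dz\Big)^{1/(p-1)}$, $r>0$. Test functions: for an open set $D'$ and $\phi\in C^2(D')$ let $N_\phi=\{x\in D':\nabla\phi(x)=0\}$ and $d_\phi(x)=\mathrm{dist}(x,N_\phi)$. For $\eta>0$, $C^2_\eta(D')$ is the set of $\phi\in C^2(D')$ with $$\sup_{x\in D'\setminus N_\phi}\Big[\frac{\min\{d_\phi(x),1\}^{\eta-1}}{|\nabla\phi(x)|}+\frac{|D^2\phi(x)|}{d_\phi(x)^{\eta-2}}\Big]<\infty .$$ Viscosity subsolution: write $\mathscr{L}u(x)=(-\Delta_p)^su(x)+H(x,\nabla u(x))$. A function $u:\mathbb{R}^n\to\mathbb{R}$ is a viscosity subsolution of $\mathscr{L}u=f$ in an open set $\Omega$ (written $\mathscr{L}u\le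 f$ in $\Omega$; here $f\equiv D$, $\Omega=B_2$) if: (i) $u$ is upper semicontinuous in $\overline\Omega$; (ii) whenever $B_r(x_0)\subset\Omega$ and $\phi\in C^2(B_r(x_0))$ satisfies $\phi(x_0)=u(x_0)$, $\phi\ge u$ in $B_r(x_0)$, and one of the following holds: (a) $p>\frac{2}{2-s}$ or $\nabla\phi(x_0)\ne0$; (b) $p\le\frac{2}{2-s}$, $\nabla\phi(x_0)=0$, $x_0$ is an isolated critical point of $\phi$, and $\phi\in C^2_\eta(B_r(x_0))$ for some $\eta>\frac{sp}{p-1}$; then $\mathscr{L}\phi_r(x_0)\le f(x_0)$, where $\phi_r=\phi$ in $B_r(x_0)$ and $\phi_r=u$ otherwise; (iii) $u_+\in L^{p-1}_{sp}(\mathbb{R}^n)$. *)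

(* Defs.v *)
From HB Require Import structures.
From mathcomp Require Import all_boot all_order all_algebra.
From mathcomp Require Import all_classical all_reals all_analysis.

Set Implicit Arguments.
Unset Strict Implicit.
Unset Printing Implicit Defensive.

Import Order.TTheory GRing.Theory Num.Theory.
Import numFieldNormedType.Exports.

Local Open Scope classical_set_scope.
Local Open Scope ring_scope.

Section lebesgue_cons.
Context {R : realType} {n : nat}.
Local Notation T := (measurableTypeR R).

Definition tuple_cons (x : T * n.-tuple T) : n.+1.-tuple T :=
  [the n.+1.-tuple T of x.1 :: x.2].

Lemma measurable_tuple_cons : measurable_fun [set: T * n.-tuple T] tuple_cons.
Proof. exact: (measurable_cons measurable_fst measurable_snd). Qed.

HB.instance Definition _ :=
  isMeasurableFun.Build _ _ _ _ tuple_cons measurable_tuple_cons.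

Definition tuple_uncons (t : n.+1.-tuple T) : T * n.-tuple T :=
  (thead t, [tuple of behead t]).

Lemma measurable_tuple_uncons :
  measurable_fun [set: n.+1.-tuple T] tuple_uncons.
Proof.
apply: measurable_fun_pair; first exact: measurable_tnth.
exact: measurable_behead.
Qed.

Lemma tuple_consK : cancel tuple_cons tuple_uncons.
Proof.
by move=> [x t]; rewrite /tuple_uncons theadE/=; congr pair; apply/val_inj.
Qed.

Variable mu : {sigma_finite_measure set (n.-tuple T) -> \bar R}.

Definition lebesgue_cons : set (n.+1.-tuple T) -> \bar R :=
  pushforward (lebesgue_measure \x mu)%E tuple_cons.

Let lebesgue_cons0 : lebesgue_cons set0 = 0%E.
Proof. exact: measure0. Qed.

Let lebesgue_cons_ge0 A : (0 <= lebesgue_cons A)%E.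
Proof. exact: measure_ge0. Qed.

Let lebesgue_cons_sigma_additive : semi_sigma_additive lebesgue_cons.
Proof. exact: measure_semi_sigma_additive. Qed.

HB.instance Definition _ := isMeasure.Build _ _ _ lebesgue_cons
  lebesgue_cons0 lebesgue_cons_ge0 lebesgue_cons_sigma_additive.

Let lebesgue_cons_sigma_finite : sigma_finite setT lebesgue_cons.
Proof.
have /sigma_finiteP[F [FT ndF Foo]] := sigma_finiteT (@lebesgue_measure R).
have /sigma_finiteP[G [GT ndG Goo]] := sigma_finiteT mu.
exists (fun k => tuple_uncons @^-1` (F k `*` G k)).
  apply/esym; rewrite -subTset => t _.
  have [i _ Fi] : (\bigcup_i F i) (tuple_uncons t).1 by rewrite -FT.
  have [j _ Gj] : (\bigcup_j G j) (tuple_uncons t).2 by rewrite -GT.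
  exists (maxn i j) => //; split.
  - by move: Fi; exact/subsetPset/ndF/leq_maxl.
  - by move: Gj; exact/subsetPset/ndG/leq_maxr.
move=> k; have [mF Fk] := Foo k; have [mG Gk] := Goo k; split.
  rewrite -[X in measurable X]setTI; apply: measurable_tuple_uncons => //.
  exact: measurableX.
rewrite /lebesgue_cons /pushforward -comp_preimage.
rewrite (_ : _ \o _ = id) ?preimage_id; last exact/funext/tuple_consK.
by rewrite product_measure1E// lte_mul_pinfty// ge0_fin_numE.
Qed.

HB.instance Definition _ := Measure_isSigmaFinite.Build _ _ _ lebesgue_cons
  lebesgue_cons_sigma_finite.

End lebesgue_cons.

Fixpoint lebesgue_tuple {R : realType} (n : nat) :
    {sigma_finite_measure set (n.-tuple (measurableTypeR R)) -> \bar R} :=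
  match n with
  | 0 => [the {sigma_finite_measure set _ -> \bar R} of
           \d_([tuple] : 0.-tuple (measurableTypeR R))]
  | n'.+1 => [the {sigma_finite_measure set _ -> \bar R} of
           lebesgue_cons (lebesgue_tuple n')]
  end.

Definition measure_rV_display : measure_display -> measure_display.
Proof. exact. Qed.

Section measurable_rV.
Context {R : realType} {n : nat}.
Local Notation T := (measurableTypeR R).
Local Notation d := (sigma_display (@measurable _ (ocitv_type R))).

Let coors : 'I_n -> 'rV[R]_n -> T := fun i x => x ord0 i.

Let rV_set0 : g_sigma_preimage coors set0.
Proof. exact: sigma_algebra0. Qed.

Let rV_setC A : g_sigma_preimage coors A -> g_sigma_preimage coors (~` A).
Proof. exact: sigma_algebraC. Qed.

Let rV_bigcup (F : (set 'rV[R]_n)^nat) :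
  (forall i, g_sigma_preimage coors (F i)) ->
  g_sigma_preimage coors (\bigcup_i (F i)).
Proof. exact: sigma_algebra_bigcup. Qed.

HB.instance Definition _ := @isMeasurable.Build
  (measure_rV_display d) 'rV[R]_n
  (g_sigma_preimage coors) rV_set0 rV_setC rV_bigcup.

End measurable_rV.

Section lebesgue_rV.
Context {R : realType} (n : nat).
Local Notation T := (measurableTypeR R).

Definition rV_of_tuple (t : n.-tuple T) : 'rV[R]_n := \row_i tnth t i.

Lemma measurable_rV_of_tuple : measurable_fun [set: n.-tuple T] rV_of_tuple.
Proof.
move=> _ A mA; rewrite setTI.
pose coors (i : 'I_n) (x : 'rV[R]_n) : T := x ord0 i.
have : preimage_set_system setT rV_of_tuple (g_sigma_preimage coors)
    (rV_of_tuple @^-1` A).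
  by exists A => //; rewrite setTI.
rewrite -g_sigma_preimage_comp /measurable/=; congr (g_sigma_preimage _ _).
by apply/funext => i; apply/funext => t; rewrite /coors/= mxE.
Qed.

HB.instance Definition _ :=
  isMeasurableFun.Build _ _ _ _ rV_of_tuple measurable_rV_of_tuple.

Definition borel_lebesgue_rV : set 'rV[R]_n -> \bar R :=
  pushforward (@lebesgue_tuple R n) rV_of_tuple.

Let borel_lebesgue_rV0 : borel_lebesgue_rV set0 = 0%E.
Proof. exact: measure0. Qed.

Let borel_lebesgue_rV_ge0 A : (0 <= borel_lebesgue_rV A)%E.
Proof. exact: measure_ge0. Qed.

Let borel_lebesgue_rV_sigma_additive : semi_sigma_additive borel_lebesgue_rV.
Proof. exact: measure_semi_sigma_additive. Qed.

HB.instance Definition _ := isMeasure.Build _ _ _ borel_lebesgue_rV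
  borel_lebesgue_rV0 borel_lebesgue_rV_ge0 borel_lebesgue_rV_sigma_additive.

End lebesgue_rV.

(* The completion of the product measure, so that [measurable_fun] on
   [lebesgue_type] is Lebesgue (and not only Borel) measurability. *)
Definition lebesgue_type (R : realType) (n : nat) :=
  caratheodory_type (@borel_lebesgue_rV R n)^*%mu.

Definition lebesgue_rV (R : realType) (n : nat) :=
  [the {measure set (lebesgue_type R n) -> \bar R} of
    @completed_measure_extension _ _ _ (@borel_lebesgue_rV R n)].

Lemma lebesgue_tuple_box (R : realType) (n : nat)
    (A : 'I_n -> set (measurableTypeR R)) : (forall i, measurable (A i)) ->
  lebesgue_tuple n [set t | forall i, A i (tnth t i)] =
  (\prod_(i < n) lebesgue_measure (A i))%E.
Proof.
elim: n A => [|n IHn] A mA /=.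
  by rewrite big_ord0 /dirac indicE mem_set// => -[].
rewrite big_ord_recl -(IHn (fun i => A (lift ord0 i)))//.
rewrite -product_measure1E//; last first.
  rewrite [X in measurable X](_ : _ = \bigcap_(i in [set: 'I_n])
    ((@tnth _ (measurableTypeR R))^~ i @^-1` A (lift ord0 i))); last first.
    by apply/seteqP; split => t /= tA i; [move=> _|]; exact: tA.
  apply: fin_bigcap_measurable => // i _.
  by rewrite -[X in measurable X]setTI; exact: measurable_tnth.
rewrite /lebesgue_cons /pushforward; congr (product_measure1 _ _ _).
apply/seteqP; split => -[x t]/=.
  move=> xtA; split; first exact: (xtA ord0).
  by move=> i; have := xtA (lift ord0 i); rewrite tnthS.
move=> [x0 tA] i; case: (unliftP ord0 i) => [j ->|->//].
by rewrite tnthS; exact: tA.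
Qed.

Lemma lebesgue_rV_box (R : realType) (n : nat)
    (A : 'I_n -> set (measurableTypeR R)) : (forall i, measurable (A i)) ->
  lebesgue_rV R n [set x : 'rV[R]_n | forall i, A i (x ord0 i)] =
  (\prod_(i < n) lebesgue_measure (A i))%E.
Proof.
move=> mA; rewrite /= /completed_measure_extension measurable_mu_extE/=.
  rewrite -lebesgue_tuple_box// /borel_lebesgue_rV /pushforward.
  congr (lebesgue_tuple n _); apply/seteqP; split => t /= tA i.
    by have := tA i; rewrite mxE.
  by rewrite mxE; exact: tA.
rewrite [X in measurable X](_ : _ = \bigcap_(i in [set: 'I_n])
    ((fun x : 'rV[R]_n => x ord0 i) @^-1` A i)); last first.
  by apply/seteqP; split => x /= xA i; [move=> _|]; exact: xA.
apply: fin_bigcap_measurable => // i _.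
apply: sub_sigma_algebra; rewrite -bigcup_seq/=.
by exists i; [rewrite /= mem_index_enum|exists (A i) => //; rewrite setTI].
Qed.

(* The library norm on 'rV[R]_n is the sup norm; it induces the same topology
   as [enorm]. *)
Section euclidean.
Context {R : realType} {n : nat}.
Implicit Types (x y : 'rV[R]_n) (r : R).

Definition enorm x : R := Num.sqrt (\sum_(i < n) x ord0 i ^+ 2).

Definition eball x r : set 'rV[R]_n := [set y | enorm (y - x) < r].

Definition ecball x r : set 'rV[R]_n := [set y | enorm (y - x) <= r].

End euclidean.

Section test_functions.
Context {R : realType} {n : nat}.
Implicit Types (D : set 'rV[R]_n) (phi : 'rV[R]_n -> R) (x : 'rV[R]_n).

Definition partial (i : 'I_n) phi : 'rV[R]_n -> R := 'D_(delta_mx ord0 i) phi.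

Definition grad phi x : 'rV[R]_n := \row_i partial i phi x.

Definition hess phi x : 'M[R]_n := \matrix_(i, j) partial j (partial i phi) x.

Definition frobenius (M : 'M[R]_n) : R :=
  Num.sqrt (\sum_(i < n) \sum_(j < n) M i j ^+ 2).

(* Meant for open D: only the values of phi on D matter then. *)
Definition C2 D phi := forall x, D x ->
  [/\ {for x, continuous phi},
      forall i, derivable phi x (delta_mx ord0 i) /\
                {for x, continuous (partial i phi)} &
      forall i j, derivable (partial i phi) x (delta_mx ord0 j) /\
                  {for x, continuous (partial j (partial i phi))}].

Definition critical D phi : set 'rV[R]_n := [set x | D x /\ grad phi x = 0].

(* As [inf set0 = 0], this is the distance to the critical set only when that
   set is nonempty, which is the case wherever [C2eta] is used. *)
Definition dist_critical D phi x : R :=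
  inf [set enorm (x - y) | y in critical D phi].

Definition C2eta (eta : R) D phi := C2 D phi /\
  has_ubound [set (Num.min (dist_critical D phi x) 1) `^ (eta - 1)
                    / enorm (grad phi x)
                  + frobenius (hess phi x)
                    / dist_critical D phi x `^ (eta - 2)
             | x in D `\` critical D phi].

End test_functions.

Section nonlocal.
Context {R : realType} {n : nat}.
Variables s p : R.
Local Notation mu := (lebesgue_rV R n).
Implicit Types (u g : 'rV[R]_n -> R) (x : 'rV[R]_n).

Definition truncated_frac_plap u x (eps : R) : \bar R :=
  (\int[mu]_(z in [set z : 'rV[R]_n | (eps <= enorm z)%R])
    (`|u x - u (x + z)| `^ (p - 2) * (u x - u (x + z))
       / enorm z `^ (n%:R + s * p))%:E)%E.

(* The principal value (-Delta_p)^s u(x) exists and equals l. It may be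
   infinite: the outer integral can be -oo when a test function blows up at the
   boundary of its ball. *)
Definition is_frac_plap u x (l : \bar R) :=
  truncated_frac_plap u x eps @[eps --> 0^'+] --> l.

Definition tail_space g :=
  [/\ measurable_fun [set: lebesgue_type R n] g,
      forall K : set 'rV[R]_n, compact K ->
        (\int[mu]_(z in K) (`|g z| `^ (p - 1))%:E < +oo)%E &
      (\int[mu]_z (`|g z| `^ (p - 1)
                     / (1 + enorm z) `^ (n%:R + s * p))%:E < +oo)%E].

Definition Tail g x (r : R) : \bar R :=
  (((r `^ (s * p))%:E *
    \int[mu]_(z in [set z : 'rV[R]_n | (r <= enorm (z - x))%R])
      (`|g z| `^ (p - 1) / enorm (z - x) `^ (n%:R + s * p))%:E)
   `^ (p - 1)^-1)%E.

End nonlocal.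

Section viscosity.
Context {R : realType} {n : nat}.
Variables s p : R.
Variable H : 'rV[R]_n -> 'rV[R]_n -> R.
Implicit Types (u phi f : 'rV[R]_n -> R) (x : 'rV[R]_n).

Definition upper_semicontinuous_in (A : set 'rV[R]_n) u :=
  forall x, A x -> forall a, u x < a -> \forall y \near within A (nbhs x), u y < a.

Definition test_replace (B : set 'rV[R]_n) phi u : 'rV[R]_n -> R :=
  fun x => if x \in B then phi x else u x.

Definition admissible_test x0 r phi :=
  (2 / (2 - s) < p \/ grad phi x0 != 0) \/
  [/\ p <= 2 / (2 - s), grad phi x0 = 0,
      isolated (critical (eball x0 r) phi) x0 &
      exists2 eta, s * p / (p - 1) < eta & C2eta eta (eball x0 r) phi].

Definition viscosity_subsolution f (Omega : set 'rV[R]_n) u :=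
  [/\ upper_semicontinuous_in (closure Omega) u,
      forall x0 r phi, 0 < r -> eball x0 r `<=` Omega -> C2 (eball x0 r) phi ->
        phi x0 = u x0 -> (forall x, eball x0 r x -> u x <= phi x) ->
        admissible_test x0 r phi ->
        let phi_r := test_replace (eball x0 r) phi u in
        exists2 l, is_frac_plap s p phi_r x0 l &
          (l + (H x0 (grad phi_r x0))%:E <= (f x0)%:E)%E &
      tail_space s p u^\+].

End viscosity.

Section hoelder.
Context {R : realType} {n : nat}.
Implicit Types (A : set 'rV[R]_n) (u : 'rV[R]_n -> R).

Definition hoelder_in (gamma : R) A u := exists C : R, forall x y, A x -> A y ->
  `|u x - u y| <= C * enorm (x - y) `^ gamma.

Definition hoelder_norm (gamma : R) A u : \bar R :=
  (ereal_sup [set `|u x|%:E | x in A] +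
   ereal_sup [set (`|u xy.1 - u xy.2| / enorm (xy.1 - xy.2) `^ gamma)%:E
             | xy in [set xy | [/\ A xy.1, A xy.2 & xy.1 != xy.2]]])%E.

End hoelder.

Definition hoelder_exponent (R : realType) (s p m gamma : R) :=
  [\/ p - 1 < s * p /\ gamma = (m - s * p) / (m - (p - 1)),
      (s * p = p - 1 \/ s * p < m <= p - 1) /\ 0 < gamma < 1 |
      s * p < p - 1 < m /\ gamma = 1].

(* Main.v *)
(* Write [M = 2 A + 1] and touch [u] from above by [u w + c |x - w| ^ gamma], where
   [c = M rho ^ (- gamma)], so that the touching point [y] satisfies
   [d := |y - w| < rho]. Testing the equation at [y] with a paraboloid tangent to
   this cone, coercivity of [H] gives a term [theta (c gamma d ^ (gamma - 1)) ^ m],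
   which has to be balanced by the nonlocal operator. The latter is bounded below by
   a multiple of [- c ^ (p - 1) d ^ (gamma (p - 1) - s p)] on [|z| < d], by
   [- c ^ (p - 1)] times the integral of [|z| ^ (gamma (p - 1) - s p - n)] on
   [d <= |z| < rho], and by a multiple of [- rho ^ (- s p)] beyond. As
   [m > s p], and [m > p - 1] whenever [gamma (p - 1) < s p], the coercive term wins
   if [rho] is small, uniformly in [w]; hence no touching point exists, which is the
   Hoelder estimate. *)
Require Import Defs.
From mathcomp Require Import all_boot all_order all_algebra.
From mathcomp Require Import all_classical all_reals all_analysis.
From mathcomp Require Import measurable_realfun ess_sup_inf.
From mathcomp Require Import lra ring.

Set Implicit Arguments.
Unset Strict Implicit.
Unset Printing Implicit Defensive.

Import Order.TTheory GRing.Theory Num.Theory.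
Import numFieldNormedType.Exports.

Local Open Scope classical_set_scope.
Local Open Scope ring_scope.

(** * Invariance of Lebesgue measure under translations and reflections *)

Lemma lebesgue_measure_sign_shift (R : realType) (c e : R) (A : set (measurableTypeR R)) :
  e ^+ 2 = 1 -> measurable A ->
  lebesgue_measure ((fun x : R => c + e * x) @^-1` A) = lebesgue_measure A.
Proof.
move=> e1 mA; have mf : measurable_fun [set: measurableTypeR R]
    (fun x : R => (c + e * x : measurableTypeR R)).
  by apply: measurable_funD => //; exact: measurable_funM.
pose f : measurableTypeR R -> measurableTypeR R := fun x : R => c + e * x.
have /(_ mf) H := @lebesgue_measure_unique R (pushforward lebesgue_measure f).
apply/esym; apply: H => //.
move=> _ [[a b]] _ <-; rewrite lebesgue_measure_itv/=.
transitivity (lebesgue_measure ((fun x : R => c + e * x) @^-1` `]a, b]%classic));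
  last by [].
move/eqP: e1; rewrite sqrf_eq1 => /orP[]/eqP e1.
- rewrite (_ : _ @^-1` _ = `]a - c, b - c]%classic); last first.
    apply/seteqP; split => x /=; rewrite !in_itv/= e1 => /andP[? ?];
      apply/andP; split; lra.
  rewrite lebesgue_measure_itv/= !lte_fin.
  have -> : (a - c < b - c) = (a < b) by lra.
  by case: ifP => // _; rewrite -!EFinD; congr EFin; lra.
- rewrite (_ : _ @^-1` _ = `[c - b, c - a[%classic); last first.
    apply/seteqP; split => x /=; rewrite !in_itv/= e1 => /andP[? ?];
      apply/andP; split; lra.
  rewrite lebesgue_measure_itv/= !lte_fin.
  have -> : (c - b < c - a) = (a < b) by lra.
  by case: ifP => // _; rewrite -!EFinD; congr EFin; lra.
Qed.

Definition box {R : realType} {n : nat} (A : 'I_n -> set (measurableTypeR R)) :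
  set 'rV[R]_n := [set x | forall i, A i (x ord0 i)].

Definition cube {R : realType} {n : nat} (r : R) : set 'rV[R]_n :=
  box (fun=> `[- r, r]%classic).

Definition sign_shift {R : realType} {n : nat} (c : 'rV[R]_n) (e : R) (x : 'rV[R]_n) :
  'rV[R]_n := c + e *: x.

Section borel_rV.
Context {R : realType} {n : nat}.
Local Notation T := (measurableTypeR R).

Lemma measurable_coord (i : 'I_n) :
  measurable_fun [set: 'rV[R]_n] (fun x : 'rV[R]_n => x ord0 i : T).
Proof.
move=> _ A mA; rewrite setTI; apply: sub_sigma_algebra; rewrite -bigcup_seq/=.
by exists i; [rewrite /= mem_index_enum|exists A => //; rewrite setTI].
Qed.

Lemma measurable_box (A : 'I_n -> set T) : (forall i, measurable (A i)) ->
  measurable (box A).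
Proof.
move=> mA; rewrite [X in measurable X](_ : _ = \bigcap_(i in [set: 'I_n])
    ((fun x : 'rV[R]_n => x ord0 i) @^-1` A i)); last first.
  by apply/seteqP; split => x /= xA i; [move=> _|]; exact: xA.
apply: fin_bigcap_measurable => // i _.
by rewrite -[X in measurable X]setTI; exact: measurable_coord.
Qed.

Let boxes : set (set 'rV[R]_n) :=
  [set box A | A in [set A : 'I_n -> set T | forall i, measurable (A i)]].

Let measurable_boxes : measurable = <<s boxes >>.
Proof.
apply/seteqP; split; last first.
  apply: smallest_sub; first exact: sigma_algebra_measurable.
  by move=> _ [A mA <-]; exact: measurable_box.
apply: smallest_sub; first exact: smallest_sigma_algebra.
rewrite -bigcup_seq => X [i _ [A mA <-]].
apply: sub_sigma_algebra; exists (fun j => if j == i then A else setT).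
  by move=> j; case: ifP.
apply/seteqP; split => x /=.
  by move=> /(_ i); rewrite eqxx.
by move=> [_ xA] j; case: eqP => // ->.
Qed.

Lemma borel_measure_unique (m1 m2 : {measure set 'rV[R]_n -> \bar R}) :
  (forall A, (forall i, measurable (A i)) -> m1 (box A) = m2 (box A)) ->
  (forall k : nat, (m1 (cube k%:R) < +oo)%E) ->
  forall X, measurable X -> m1 X = m2 X.
Proof.
move=> m12 m1oo; apply: (measure_unique boxes
    (fun k => cube k%:R)).
- exact: measurable_boxes.
- move=> _ _ [A mA <-] [B mB <-]; exists (fun i => A i `&` B i).
    by move=> i; exact: measurableI.
  apply/seteqP; split => x /=.
    by move=> xAB; split => i; have [] := xAB i.
  by move=> [xA xB] i; split.
- by move=> k; exists (fun=> `[- (k%:R : R), k%:R]%classic) => //.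
- apply/seteqP; split => // x _.
  have [k kx] : exists k : nat, forall i, `|x ord0 i| <= k%:R.
    exists (\max_i (Num.bound (x ord0 i))) => i.
    apply/ltW/(lt_le_trans (archi_boundP (normr_ge0 _))).
    rewrite ler_nat; apply: leq_trans (leq_bigmax i) => /=.
    by rewrite /Num.bound normr_id.
  by exists k => // i /=; rewrite in_itv/= -ler_norml.
- by move=> _ [A mA <-]; exact: m12.
- exact: m1oo.
Qed.

End borel_rV.

Section invariance.
Context {R : realType} {n : nat}.
Local Notation T := (measurableTypeR R).
Local Notation mu0 := (@borel_lebesgue_rV R n).

Lemma measurable_sign_shift_borel (c : 'rV[R]_n) (e : R) :
  measurable_fun [set: 'rV[R]_n] (sign_shift c e).
Proof.
move=> _; apply: measurability => //= X.
rewrite -bigcup_seq => -[Y [i _ [A mA <-]] <-].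
rewrite !setTI.
rewrite (_ : _ @^-1` _ = (fun x : 'rV[R]_n => c ord0 i + e * x ord0 i : T) @^-1` A).
  rewrite -[X in measurable X]setTI.
  have : measurable_fun [set: 'rV[R]_n]
     (fun x : 'rV[R]_n => c ord0 i + e * x ord0 i : T).
    apply: measurable_funD => //; apply: measurable_funM => //.
    exact: measurable_coord.
  exact.
by apply/funext => x; rewrite /preimage /= !mxE.
Qed.

Lemma borel_lebesgue_box (A : 'I_n -> set T) : (forall i, measurable (A i)) ->
  mu0 (box A) = (\prod_(i < n) lebesgue_measure (A i))%E.
Proof.
move=> mA; rewrite -lebesgue_tuple_box//.
rewrite /borel_lebesgue_rV /pushforward; congr (lebesgue_tuple n _).
apply/seteqP; split => t /= tA i.
  by have := tA i; rewrite mxE.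
by rewrite mxE; exact: tA.
Qed.

Lemma borel_lebesgue_cube (r : R) : 0 <= r -> mu0 (cube r) = ((2 * r) ^+ n)%:E.
Proof.
move=> r0; rewrite /cube borel_lebesgue_box//.
transitivity (\prod_(i < n) (2 * r)%:E)%E.
  apply: eq_bigr => i _; rewrite lebesgue_measure_itv/= lte_fin.
  case: ifPn => [_|]; first by rewrite -EFinD opprK; congr EFin; lra.
  by rewrite -leNgt => k0; congr EFin; lra.
by rewrite prodEFin prodr_const card_ord.
Qed.

Lemma borel_lebesgue_sign_shift (c : 'rV[R]_n) (e : R) (X : set 'rV[R]_n) :
  e ^+ 2 = 1 -> measurable X -> mu0 (sign_shift c e @^-1` X) = mu0 X.
Proof.
move=> e1 mX.
have mf := measurable_sign_shift_borel c e.
apply/esym.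
have /(_ mf) H := @borel_measure_unique R n mu0 (pushforward mu0 (sign_shift c e)).
apply: H => //.
- move=> A mA; rewrite [LHS]borel_lebesgue_box//.
  transitivity (mu0 (sign_shift c e @^-1` box A)); last by [].
  have -> : sign_shift c e @^-1` box A =
      box (fun i => (fun x : R => c ord0 i + e * x) @^-1` A i).
    by apply/seteqP; split => x /= xA i; have := xA i; rewrite /= !mxE.
  rewrite [RHS]borel_lebesgue_box; last first.
    move=> i; rewrite -[X in measurable X]setTI.
    have : measurable_fun [set: T] (fun x : R => c ord0 i + e * x : T).
      by apply: measurable_funD => //; exact: measurable_funM.
    exact.
  apply: eq_bigr => i _; apply/esym/lebesgue_measure_sign_shift => //.
- by move=> k; rewrite [X in (X < _)%E]borel_lebesgue_cube ?ltry.
Qed.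

Local Notation mu := (lebesgue_rV R n).

Lemma sign_shiftVK (c : 'rV[R]_n) (e : R) : e ^+ 2 = 1 ->
  cancel (sign_shift (- (e *: c)) e) (sign_shift c e).
Proof.
move=> e1 x; rewrite /sign_shift scalerDr scalerN !scalerA.
by rewrite -expr2 e1 !scale1r addrA subrr add0r.
Qed.

(* [lebesgue_rV] is defined on every set as an outer measure, so that its
   invariance passes from Borel sets to arbitrary ones through Borel covers. *)
Lemma le_outer_sign_shift (c : 'rV[R]_n) (e : R) (X : set 'rV[R]_n) :
  e ^+ 2 = 1 -> (mu (sign_shift c e @^-1` X) <= mu X)%E.
Proof.
move=> e1; apply: le_ereal_inf_tmp => _ [F [mF XF] <-].
apply: ereal_inf_lbound; exists (fun k => sign_shift c e @^-1` F k).
  split=> [k|x /XF[k _ Fk]]; last by exists k.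
  by rewrite -[X in measurable X]setTI; exact: measurable_sign_shift_borel.
by apply: eq_eseriesr => k _; exact: borel_lebesgue_sign_shift.
Qed.

Lemma lebesgue_rV_sign_shift (c : 'rV[R]_n) (e : R) (X : set 'rV[R]_n) :
  e ^+ 2 = 1 -> mu (sign_shift c e @^-1` X) = mu X.
Proof.
move=> e1; apply/eqP; rewrite eq_le le_outer_sign_shift//=.
rewrite [X in (X <= _)%E](_ : _ =
  mu (sign_shift (- (e *: c)) e @^-1` (sign_shift c e @^-1` X))).
  exact: le_outer_sign_shift.
by congr (mu _); apply/seteqP; split => x; rewrite /preimage/= sign_shiftVK.
Qed.

Lemma measurable_sign_shift (c : 'rV[R]_n) (e : R) : e ^+ 2 = 1 ->
  measurable_fun [set: lebesgue_type R n]
    (sign_shift c e : lebesgue_type R n -> lebesgue_type R n).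
Proof.
move=> e1 _ X mX; rewrite setTI.
suff: caratheodory_measurable mu (sign_shift c e @^-1` X) by [].
move=> Y.
have h Z : mu Z = mu (sign_shift (- (e *: c)) e @^-1` Z).
  apply/esym/lebesgue_rV_sign_shift => //.
have hI Z : sign_shift (- (e *: c)) e @^-1` (Y `&` sign_shift c e @^-1` Z) =
  (sign_shift (- (e *: c)) e @^-1` Y) `&` Z.
  by apply/seteqP; split => x; rewrite /preimage/= sign_shiftVK.
rewrite [LHS]h [X in (X + _)%E]h [X in (_ + X)%E]h.
by rewrite (hI X) (hI (~` X)); exact: mX.
Qed.

Lemma ge0_integral_sign_shift (c : 'rV[R]_n) (e : R) (D : set (lebesgue_type R n))
    (f : lebesgue_type R n -> \bar R) : e ^+ 2 = 1 ->
  measurable D -> measurable_fun D f -> (forall x, D x -> 0 <= f x)%E ->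
  (\int[mu]_(x in D) f x =
   \int[mu]_(x in sign_shift c e @^-1` D) f (sign_shift c e x))%E.
Proof.
move=> e1 mD mf f0.
have mT := measurable_sign_shift c e1.
rewrite -(ge0_integral_pushforward mT mu mD mf); last by move=> x /set_mem/f0.
apply: eq_measure_integral => A mA AD.
by apply/esym; exact: lebesgue_rV_sign_shift.
Qed.

Lemma measurable_borel_lebesgue (X : set 'rV[R]_n) : measurable X ->
  measurable (X : set (lebesgue_type R n)).
Proof. exact: caratheodory_measurable_mu_ext. Qed.

Lemma lebesgue_rV_cube (r : R) : 0 <= r -> mu (cube r) = ((2 * r) ^+ n)%:E.
Proof.
move=> r0; rewrite -borel_lebesgue_cube//=.
rewrite /completed_measure_extension measurable_mu_extE//.
exact: measurable_box.
Qed.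

End invariance.

(** * The Euclidean norm *)

Section euclidean_norm.
Context {R : realType} {n : nat}.
Implicit Types x y z : 'rV[R]_n.

Definition dotp x y : R := \sum_(i < n) x ord0 i * y ord0 i.

Lemma enorm_ge0 x : 0 <= enorm x.
Proof. exact: sqrtr_ge0. Qed.

Lemma sqr_enorm x : enorm x ^+ 2 = dotp x x.
Proof.
rewrite /enorm sqr_sqrtr; last by apply: sumr_ge0 => i _; exact: sqr_ge0.
by apply: eq_bigr => i _; rewrite expr2.
Qed.

Lemma dotpC x y : dotp x y = dotp y x.
Proof. by apply: eq_bigr => i _; rewrite mulrC. Qed.

Lemma dotpDr x y z : dotp x (y + z) = dotp x y + dotp x z.
Proof. by rewrite -big_split/=; apply: eq_bigr => i _; rewrite mxE mulrDr. Qed.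

Lemma dotpDl x y z : dotp (x + y) z = dotp x z + dotp y z.
Proof. by rewrite dotpC dotpDr !(dotpC z). Qed.

Lemma dotpZr (a : R) x y : dotp x (a *: y) = a * dotp x y.
Proof. by rewrite /dotp mulr_sumr; apply: eq_bigr => i _; rewrite mxE mulrCA. Qed.

Lemma dotpZl (a : R) x y : dotp (a *: x) y = a * dotp x y.
Proof. by rewrite dotpC dotpZr dotpC. Qed.

Lemma sqr_enormD x y :
  enorm (x + y) ^+ 2 = enorm x ^+ 2 + 2 * dotp x y + enorm y ^+ 2.
Proof. by rewrite !sqr_enorm dotpDr !dotpDl (dotpC y x); ring. Qed.

Lemma enormZ (a : R) x : enorm (a *: x) = `|a| * enorm x.
Proof.
apply/eqP; rewrite -(@eqrXn2 _ 2) ?mulr_ge0 ?enorm_ge0//; apply/eqP.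
by rewrite exprMn sqr_enorm dotpZr dotpZl mulrA -sqr_enorm -expr2 -normrX ger0_norm ?sqr_ge0.
Qed.

Lemma enormN x : enorm (- x) = enorm x.
Proof. by rewrite -scaleN1r enormZ normrN1 mul1r. Qed.

Lemma enorm_subC x y : enorm (x - y) = enorm (y - x).
Proof. by rewrite -enormN opprB. Qed.

Lemma enorm0 : enorm (0 : 'rV[R]_n) = 0.
Proof. by rewrite -(scale0r 0) enormZ normr0 mul0r. Qed.

Lemma coord_le_enorm x i : `|x ord0 i| <= enorm x.
Proof.
rewrite -(@ler_pXn2r _ 2) ?nnegrE ?enorm_ge0// sqr_enorm -normrX ger0_norm ?sqr_ge0//.
rewrite /dotp (bigD1 i)//= -expr2 lerDl; apply: sumr_ge0 => j _.
by rewrite -expr2 sqr_ge0.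
Qed.

Lemma enorm_eq0 x : (enorm x == 0) = (x == 0).
Proof.
apply/eqP/eqP => [x0|->]; last exact: enorm0.
apply/rowP => i; rewrite mxE; apply/eqP; rewrite -normr_le0 -x0.
exact: coord_le_enorm.
Qed.

Lemma enorm_gt0 x : (0 < enorm x) = (x != 0).
Proof. by rewrite lt0r enorm_ge0 andbT enorm_eq0. Qed.

Lemma dotp_le x y : dotp x y <= enorm x * enorm y.
Proof.
have [->|x0] := eqVneq x 0.
  by rewrite -(scale0r 0) dotpZl enormZ normr0 !mul0r.
have [->|y0] := eqVneq y 0.
  by rewrite -(scale0r 0) dotpZr enormZ normr0 !mul0r mulr0.
rewrite -enorm_gt0 in x0; rewrite -enorm_gt0 in y0.
have := sqr_ge0 (enorm (enorm y *: x - enorm x *: y)).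
rewrite sqr_enormD enormN !enormZ !ger0_norm ?enorm_ge0// -scaleN1r.
rewrite dotpZl !dotpZr => h.
have {h} : 0 <= (enorm x * enorm y) * (enorm x * enorm y - dotp x y) by nra.
by rewrite pmulr_rge0 ?mulr_gt0// subr_ge0.
Qed.

Lemma normr_dotp_le x y : `|dotp x y| <= enorm x * enorm y.
Proof.
rewrite ler_norml dotp_le andbT -(enormN x) lerNl -mulN1r -dotpZl scaleN1r.
exact: dotp_le.
Qed.

Lemma ler_enormD x y : enorm (x + y) <= enorm x + enorm y.
Proof.
rewrite -(@ler_pXn2r _ 2) ?nnegrE ?addr_ge0 ?enorm_ge0//.
by rewrite sqr_enormD; have := dotp_le x y; nra.
Qed.

Lemma ler_enormB x y : enorm x - enorm y <= enorm (x + y).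
Proof. by rewrite lerBlDr -{1}[x](addrK y) -[in leRHS](enormN y) ler_enormD. Qed.

Lemma enorm_ball_cube r : [set x | enorm x < r] `<=` (cube r : set 'rV[R]_n).
Proof.
move=> x /= xr i /=; rewrite in_itv/= -ler_norml.
exact: le_trans (coord_le_enorm x i) (ltW xr).
Qed.

Lemma continuous_coord (i : 'I_n) : continuous (fun x : 'rV[R]_n => x ord0 i).
Proof. exact: coord_continuous. Qed.

Lemma continuous_enorm : continuous (enorm : 'rV[R]_n -> R).
Proof.
move=> x; apply: continuous_comp; last exact: sqrt_continuous.
elim: (index_enum _) => [|i l IH].
  have -> : (fun y : 'rV[R]_n => \sum_(j <- [::]) y ord0 j ^+ 2) = cst 0.
    by apply/funext => y; rewrite big_nil.
  exact: cst_continuous.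
have -> : (fun y : 'rV[R]_n => \sum_(j <- i :: l) y ord0 j ^+ 2) =
  (fun y => y ord0 i * y ord0 i + \sum_(j <- l) y ord0 j ^+ 2).
  by apply/funext => y; rewrite big_cons expr2.
apply: (@continuousD _ _ _ (fun y : 'rV[R]_n => y ord0 i * y ord0 i)); last exact: IH.
by apply: (@continuousM _ _ (fun y : 'rV[R]_n => y ord0 i)); exact: continuous_coord.
Qed.

Local Notation L := (lebesgue_type R n).

Lemma lebesgue_measurable_coord (i : 'I_n) :
  measurable_fun [set: L] (fun x : L => (x : 'rV[R]_n) ord0 i : R).
Proof.
move=> mT A mA; rewrite setTI; apply: measurable_borel_lebesgue.
by rewrite -[X in measurable X]setTI; exact: (measurable_coord i).
Qed.

Lemma measurable_dotp x : measurable_fun [set: L] (fun y : L => dotp x y).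
Proof.
apply: measurable_sum => i.
exact: measurable_funM (measurable_cst _) (lebesgue_measurable_coord i).
Qed.

Lemma measurable_enorm : measurable_fun [set: L] (enorm : L -> R).
Proof.
have ms : measurable_fun [set: R] (Num.sqrt : R -> R).
  by apply: continuous_measurable_fun => t; exact: sqrt_continuous.
have mq : measurable_fun [set: L] (fun x : L => \sum_(i < n) (x : 'rV[R]_n) ord0 i ^+ 2).
  by apply: measurable_sum => i; apply: measurable_funX; exact: lebesgue_measurable_coord.
exact: (measurableT_comp ms mq).
Qed.

End euclidean_norm.

(** * Powers, signed powers and dyadic shells *)

Lemma powR_add (R : realType) (x a b : R) : 0 < x -> x `^ (a + b) = x `^ a * x `^ b.
Proof. by move=> x0; rewrite powRD//; apply/implyP => _; rewrite gt_eqF. Qed.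

Lemma powR_expr (R : realType) (x a : R) (k : nat) : 0 <= x ->
  (x ^+ k) `^ a = (x `^ a) ^+ k.
Proof.
by move=> x0; rewrite -(powR_mulrn k x0) -(powR_mulrn k (powR_ge0 x a)) -!powRrM [_ * a]mulrC.
Qed.

Lemma powR_le (R : realType) (a x y : R) : 0 <= a -> 0 <= x -> x <= y ->
  x `^ a <= y `^ a.
Proof.
move=> a0 x0 xy; apply: (ge0_ler_powR a0) => //; rewrite nnegrE//.
exact: le_trans x0 xy.
Qed.

Lemma powR_lt (R : realType) (a x y : R) : 0 < a -> 0 <= x -> x < y ->
  x `^ a < y `^ a.
Proof.
move=> a0 x0 xy; apply: (gt0_ltr_powR a0) => //; rewrite nnegrE//.
exact: le_trans x0 (ltW xy).
Qed.

Lemma powR1l (R : realType) (a : R) : (1 : R) `^ a = 1.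
Proof. by rewrite powR1. Qed.

Lemma powR_lt1 (R : realType) (x a : R) : 0 <= x < 1 -> 0 < a -> x `^ a < 1.
Proof.
move=> /andP[x0 x1] a0; rewrite -(powR1l a).
exact: powR_lt.
Qed.

Lemma powR_ge1 (R : realType) (x a : R) : 1 <= x -> 0 <= a -> 1 <= x `^ a.
Proof. by move=> x1 a0; have := powR_le a0 ler01 x1; rewrite powR1l. Qed.

Lemma powR_gt1 (R : realType) (x a : R) : 1 < x -> 0 < a -> 1 < x `^ a.
Proof. by move=> x1 a0; have := powR_lt a0 ler01 x1; rewrite powR1l. Qed.

Lemma powR2_lt1 (R : realType) (a : R) : a < 0 -> (2 : R) `^ a < 1.
Proof.
move=> a0; rewrite -[a]opprK powRN invf_lt1 ?powR_gt0//.
by apply: powR_gt1; rewrite ?oppr_gt0// ltr1n.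
Qed.

Section signed_power.
Context {R : realType} (p : R).
Hypothesis p_gt1 : 1 < p.

Definition spow (t : R) : R := `|t| `^ (p - 2) * t.

Lemma spow_ge0E (t : R) : 0 <= t -> spow t = t `^ (p - 1).
Proof.
rewrite le_eqVlt /spow => /orP[/eqP <-|t0].
  by rewrite mulr0 powR0// subr_eq0 gt_eqF.
rewrite gtr0_norm// -[X in _ * X](powRr1 (ltW t0)) -powR_add//.
by congr powR; lra.
Qed.

Lemma spowN t : spow (- t) = - spow t.
Proof. by rewrite /spow normrN mulrN. Qed.

Lemma spow_ge0 (t : R) : 0 <= t -> 0 <= spow t.
Proof. by move=> t0; rewrite spow_ge0E// powR_ge0. Qed.

Lemma ge0_ler_spow (s t : R) : 0 <= s -> s <= t -> spow s <= spow t.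
Proof.
move=> s0 st; have t0 := le_trans s0 st; rewrite !spow_ge0E//.
by apply: powR_le => //; rewrite subr_ge0 ltW.
Qed.

Lemma ler_spow s t : s <= t -> spow s <= spow t.
Proof.
move=> st; have [s0|s0] := leP 0 s; first exact: ge0_ler_spow.
have [t0|t0] := leP 0 t.
  apply: (@le_trans _ _ 0); last exact: spow_ge0.
  by rewrite -(opprK s) spowN oppr_le0 spow_ge0//; lra.
rewrite -lerN2 -!spowN; apply: ge0_ler_spow; lra.
Qed.

Lemma spowM (a t : R) : 0 <= a -> spow (a * t) = a `^ (p - 1) * spow t.
Proof.
move=> a0; have [t0|t0] := leP 0 t.
  by rewrite !spow_ge0E ?mulr_ge0// powRM.
have {t0} [v v0 ->] : exists2 v : R, 0 <= v & t = - v.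
  by exists (- t); rewrite ?opprK// oppr_ge0 ltW.
by rewrite mulrN !spowN mulrN !spow_ge0E ?mulr_ge0// powRM.
Qed.

Lemma measurable_spow : measurable_fun [set: R] spow.
Proof.
apply: measurable_funM => //.
exact: (measurableT_comp (@measurable_powR R (p - 2)) (@normr_measurable R _)).
Qed.

End signed_power.

Section shells.
Context {R : realType} {n : nat}.
Local Notation L := (lebesgue_type R n).
Local Notation mu := (lebesgue_rV R n).

Definition shell (r : R) : set L := [set z | r <= enorm z < 2 * r].

Lemma measurable_enorm_lt (r : R) : measurable ([set z | enorm z < r] : set L).
Proof.
rewrite (_ : mkset _ = enorm @^-1` `]-oo, r[%classic).
  by rewrite -[X in measurable X]setTI; exact: measurable_enorm.
by apply/seteqP; split => z /=; rewrite in_itv.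
Qed.

Lemma measurable_enorm_ge (r : R) : measurable ([set z | r <= enorm z] : set L).
Proof.
rewrite (_ : mkset _ = ~` [set z | enorm z < r]).
  exact/measurableC/measurable_enorm_lt.
by apply/seteqP; split => z /=; rewrite leNgt => /negP.
Qed.

Lemma measurable_annulus (a b : R) : measurable ([set z | a < enorm z < b] : set L).
Proof.
rewrite (_ : mkset _ = enorm @^-1` `]a, b[%classic).
  by rewrite -[X in measurable X]setTI; exact: measurable_enorm.
by apply/seteqP; split => z /=; rewrite in_itv.
Qed.

Lemma measurable_shell (r : R) : measurable (shell r).
Proof.
rewrite (_ : shell r = [set z | r <= enorm z] `&` [set z | enorm z < 2 * r]).
  by apply: measurableI; [exact: measurable_enorm_ge|exact: measurable_enorm_lt].
by apply/seteqP; split => z /= => [/andP[]|[? ?]] //; apply/andP.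
Qed.

Lemma lebesgue_ball_le (r : R) : 0 <= r ->
  (mu [set z | (enorm z < r)%R] <= ((2 * r) ^+ n)%:E)%E.
Proof.
move=> r0; rewrite -lebesgue_rV_cube//; apply: le_measure; rewrite ?inE.
- exact: measurable_enorm_lt.
- by apply: measurable_borel_lebesgue; exact: measurable_box.
- exact: enorm_ball_cube.
Qed.

Lemma ge0_integral_le_bound (D : set L) (f : L -> \bar R) (c : R) : measurable D ->
  measurable_fun D f -> (forall x, D x -> 0 <= f x <= c%:E)%E ->
  (\int[mu]_(x in D) f x <= c%:E * mu D)%E.
Proof.
move=> mD mf fc; rewrite -integral_cst//; apply: ge0_le_integral => //.
- by move=> x /fc/andP[].
- by move=> x /fc/andP[].
Qed.

Lemma shell_subset_ball (r : R) : shell r `<=` [set z | enorm z < 2 * r].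
Proof. by move=> z /= /andP[]. Qed.

Lemma integral_shell_le_bound (r c : R) (f : L -> \bar R) : 0 <= r -> 0 <= c ->
  measurable_fun (shell r) f -> (forall x, shell r x -> 0 <= f x <= c%:E)%E ->
  (\int[mu]_(x in shell r) f x <= (c * (4 * r) ^+ n)%:E)%E.
Proof.
move=> r0 c0 mf fc.
apply: (le_trans (ge0_integral_le_bound (measurable_shell r) mf fc)).
rewrite EFinM lee_wpmul2l ?lee_fin//.
apply: (@le_trans _ _ (mu [set z | enorm z < 2 * r])).
  apply: le_measure; rewrite ?inE; [exact: measurable_shell|
    exact: measurable_enorm_lt|exact: shell_subset_ball].
by rewrite (_ : 4 * r = 2 * (2 * r)) ?lebesgue_ball_le//; lra.
Qed.

Lemma trivIset_shell_in (b : R) : 0 < b ->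
  trivIset setT (fun k : nat => shell (b * 2^-1 ^+ k)).
Proof.
move=> b0.
suff H j k z : (j < k)%N -> shell (b * 2^-1 ^+ j) z -> ~ shell (b * 2^-1 ^+ k) z.
  move=> j k _ _ [z [zj zk]]; case: (ltngtP j k) => // jk.
    by case: (H _ _ _ jk zj).
  by case: (H _ _ _ jk zk).
move=> jk /andP[h1 _] /andP[_ h2]; have := le_lt_trans h1 h2.
apply/negP; rewrite -leNgt mulrCA ler_pM2l//.
rewrite -(subnKC jk) exprD exprS !mulrA divff// mul1r ler_piMr ?exprn_ge0//.
by apply: exprn_ile1; lra.
Qed.

Lemma trivIset_shell_out (b : R) : 0 < b ->
  trivIset setT (fun k : nat => shell (b * 2 ^+ k)).
Proof.
move=> b0.
suff H j k z : (j < k)%N -> shell (b * 2 ^+ j) z -> ~ shell (b * 2 ^+ k) z.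
  move=> j k _ _ [z [zj zk]]; case: (ltngtP j k) => // jk.
    by case: (H _ _ _ jk zj).
  by case: (H _ _ _ jk zk).
move=> jk /andP[_ h1] /andP[h2 _]; have := le_lt_trans h2 h1.
apply/negP; rewrite -leNgt mulrCA ler_pM2l// -exprS.
by rewrite -(subnKC jk) exprD ler_peMr ?exprn_ge0//; apply: exprn_ege1; lra.
Qed.

Lemma shell_in_cover (r : R) : 0 < r ->
  [set z | 0 < enorm z < r] `<=` \bigcup_k shell (r / 2 * 2^-1 ^+ k).
Proof.
move=> r0 z /= /andP[z0 zr].
have ex : exists k, (r / 2 * 2^-1 ^+ k <= enorm z)%R.
  have [k hk] : exists k : nat, r / enorm z < k%:R.
    by exists (Num.bound (r / enorm z)); apply: archi_boundP; rewrite divr_ge0 ?ltW.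
  exists k; rewrite exprVn ler_pdivrMr ?exprn_gt0//.
  have k2 : k%:R <= (2 ^+ k : R) by rewrite -natrX ler_nat ltnW// ltn_expl.
  move: hk; rewrite ltr_pdivrMr// => hk.
  have : enorm z * k%:R <= enorm z * 2 ^+ k by rewrite ler_pM2l.
  by nra.
case: (ex_minnP ex) => k hk mk; exists k => //; apply/andP; split => //.
case: k hk mk => [|k] _ mk; first by rewrite expr0 mulr1 mulrC divfK.
have : ~~ (r / 2 * 2^-1 ^+ k <= enorm z) by apply/negP => /mk; rewrite ltnn.
by rewrite -ltNge => /lt_le_trans; apply; rewrite exprS; lra.
Qed.

Lemma shell_out_cover (r : R) : 0 < r ->
  [set z | r <= enorm z] `<=` \bigcup_k shell (r * 2 ^+ k).
Proof.
move=> r0 z /= zr; have z0 := lt_le_trans r0 zr.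
have ex : exists k, (enorm z < 2 * (r * 2 ^+ k))%R.
  have [k hk] : exists k : nat, enorm z / r < k%:R.
    by exists (Num.bound (enorm z / r)); apply: archi_boundP; rewrite divr_ge0 ?ltW.
  exists k.
  have k2 : k%:R <= (2 ^+ k : R) by rewrite -natrX ler_nat ltnW// ltn_expl.
  move: hk; rewrite ltr_pdivrMr// => hk.
  have : r * k%:R <= r * 2 ^+ k by rewrite ler_pM2l.
  by nra.
case: (ex_minnP ex) => k hk mk; exists k => //; apply/andP; split => //.
case: k hk mk => [|k] _ mk; first by rewrite expr0 mulr1.
have : ~~ (enorm z < 2 * (r * 2 ^+ k)) by apply/negP => /mk; rewrite ltnn.
by rewrite -leNgt exprS; apply: le_trans; lra.
Qed.

Lemma integral_bigcup_geometric (F : nat -> set L) (D : set L) (f : L -> \bar R) (c q : R) :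
  (forall k, measurable (F k)) -> trivIset setT F -> measurable D ->
  D `<=` \bigcup_k F k -> measurable_fun setT f -> (forall x, 0 <= f x)%E ->
  0 <= c -> 0 < q < 1 ->
  (forall k, \int[mu]_(x in F k) f x <= (c * q ^+ k)%:E)%E ->
  (\int[mu]_(x in D) f x <= (c / (1 - q))%:E)%E.
Proof.
move=> mF tF mD DF mf f0 c0 /andP[q0 q1] h.
apply: (@le_trans _ _ (\int[mu]_(x in \bigcup_k F k) f x)%E).
  apply: ge0_subset_integral => //; first exact: bigcupT_measurable.
  exact: measurable_funTS.
rewrite ge0_integral_bigcup//; last exact: measurable_funTS.
apply: lime_le.
  by apply: is_cvg_nneseries => k _ _; exact: integral_ge0.
apply: nearW => N.
apply: (@le_trans _ _ (\sum_(0 <= k < N) (c * q ^+ k)%:E)%E).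
  exact: lee_sum.
rewrite sumEFin lee_fin; apply: (@geometric_le_lim R N c q) => //.
by rewrite gtr0_norm.
Qed.

Lemma measurable_powR_enorm (a : R) :
  measurable_fun [set: L] (fun z : L => enorm z `^ a).
Proof. exact: (measurableT_comp (measurable_powR a) measurable_enorm). Qed.

Lemma powR_shell_le (a r x : R) : 0 < r -> r <= x < 2 * r ->
  x `^ a <= 2 `^ `|a| * r `^ a.
Proof.
move=> r0 /andP[rx xr]; have x0 := lt_le_trans r0 rx.
have [a0|a0] := leP 0 a.
  rewrite ger0_norm// -powRM//; last exact: ltW.
  by apply: powR_le => //; exact: ltW.
apply: (@le_trans _ _ (r `^ a)).
  have {a0} [b b0 ->] : exists2 b, 0 <= b & a = - b.
    by exists (- a); rewrite ?opprK// oppr_ge0 ltW.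
  rewrite !powRN lef_pV2 ?posrE ?powR_gt0//.
  by apply: powR_le => //; exact: ltW.
by rewrite ler_peMl ?powR_ge0// powR_ge1// ler1n.
Qed.

Definition shell_const (a : R) : R := 2 `^ `|a - n%:R| * 4 ^+ n.

Lemma shell_const_ge0 a : 0 <= shell_const a.
Proof. by rewrite mulr_ge0 ?powR_ge0. Qed.

Lemma integral_shell_powR (a r : R) : 0 < r ->
  (\int[mu]_(z in shell r) (enorm z `^ (a - n%:R))%:E <=
    (shell_const a * r `^ a)%:E)%E.
Proof.
move=> r0; apply: (@le_trans _ _ (2 `^ `|a - n%:R| * r `^ (a - n%:R) * (4 * r) ^+ n)%:E).
  apply: integral_shell_le_bound => //; first exact: ltW.
  - by rewrite mulr_ge0 ?powR_ge0.
  - by apply: measurable_funTS; exact/measurable_EFinP/measurable_powR_enorm.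
  - by move=> z sz; rewrite !lee_fin powR_ge0/=; exact: powR_shell_le.
rewrite lee_fin /shell_const exprMn -(powR_mulrn n (ltW r0)).
rewrite [X in _ <= _ * r `^ X](_ : a = (a - n%:R) + n%:R); last by lra.
by rewrite [X in _ <= _ * X]powR_add// le_eqVlt; apply/orP; left; apply/eqP; ring.
Qed.

Lemma integral_powR_out (a r : R) : 0 < r -> a < 0 ->
  (\int[mu]_(z in [set z | (r <= enorm z)%R]) (enorm z `^ (a - n%:R))%:E <=
    (shell_const a / (1 - 2 `^ a) * r `^ a)%:E)%E.
Proof.
move=> r0 a0.
rewrite mulrAC; apply: (integral_bigcup_geometric (F := fun k => shell (r * 2 ^+ k))).
- by move=> k; exact: measurable_shell.
- exact: trivIset_shell_out.
- exact: measurable_enorm_ge.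
- exact: shell_out_cover.
- exact/measurable_EFinP/measurable_powR_enorm.
- by move=> z; rewrite lee_fin powR_ge0.
- by rewrite mulr_ge0 ?powR_ge0 ?shell_const_ge0.
- by rewrite powR_gt0//= powR2_lt1.
- move=> k; apply: le_trans (integral_shell_powR _ _) _.
    by rewrite mulr_gt0 ?exprn_gt0.
  by rewrite powRM ?exprn_ge0 ?(ltW r0)// powR_expr// mulrA.
Qed.

Lemma integral_powR_in (a r : R) : 0 < r -> 0 < a ->
  (\int[mu]_(z in [set z | (0 < enorm z < r)%R]) (enorm z `^ (a - n%:R))%:E <=
    (shell_const a / (1 - 2^-1 `^ a) * r `^ a)%:E)%E.
Proof.
move=> r0 a0.
apply: (@le_trans _ _ (shell_const a * (r / 2) `^ a / (1 - 2^-1 `^ a))%:E).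
  apply: (integral_bigcup_geometric (F := fun k => shell (r / 2 * 2^-1 ^+ k))).
  - by move=> k; exact: measurable_shell.
  - by apply: trivIset_shell_in; rewrite divr_gt0.
  - exact: measurable_annulus.
  - exact: shell_in_cover.
  - exact/measurable_EFinP/measurable_powR_enorm.
  - by move=> z; rewrite lee_fin powR_ge0.
  - by rewrite mulr_ge0 ?powR_ge0 ?shell_const_ge0.
  - by rewrite powR_gt0//= powR_lt1//; lra.
  - move=> k; apply: le_trans (integral_shell_powR _ _) _.
      by rewrite mulr_gt0 ?exprn_gt0// divr_gt0.
    by rewrite powRM ?exprn_ge0 ?divr_ge0 ?(ltW r0)// powR_expr// mulrA.
rewrite lee_fin mulrAC ler_wpM2l//.
  rewrite divr_ge0 ?shell_const_ge0// subr_ge0 ltW// powR_lt1//; lra.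
by apply: powR_le; lra.
Qed.

End shells.

(** * The nonlocal operator on a paraboloid *)

Section near_estimate.
Context {R : realType} {n : nat} (p : R).
Hypothesis p_gt1 : 1 < p.
Local Notation L := (lebesgue_type R n).
Local Notation mu := (lebesgue_rV R n).
Implicit Types v z : 'rV[R]_n.
Local Notation J := (spow p).

Lemma measurable_spow_dotp v (f : L -> R) : measurable_fun setT f ->
  measurable_fun [set: L] (fun z : L => J (2 * dotp v z + f z)).
Proof.
move=> mf; apply: (measurableT_comp (measurable_spow p)).
exact: measurable_funD (measurable_funM (measurable_cst _) (measurable_dotp v)) mf.
Qed.

(* Translating [z] by [- j r^2 v / |v|^2] moves the argument [2 v.z] by
   [- 2 j r^2], which makes the summands telescope in [integral_spow_diff_ball]. *)
Lemma integral_spow_shift_le v (r : R) (j : nat) :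
  0 < enorm v -> 0 <= r -> j%:R * r <= enorm v ->
  (\int[mu]_(z in [set z | (enorm z < r)%R])
     (J (2 * dotp v z + r ^+ 2) - J (2 * dotp v z - r ^+ 2))%:E <=
   \int[mu]_(z in [set z | (enorm z < 2 * r)%R])
     (J (2 * dotp v z + (r ^+ 2 - j%:R * (2 * r ^+ 2)))
      - J (2 * dotp v z + (r ^+ 2 - j.+1%:R * (2 * r ^+ 2))))%:E)%E.
Proof.
move=> v0 r0 jr; pose c : 'rV[R]_n := (- (j%:R * r ^+ 2 / enorm v ^+ 2)) *: v.
pose f (z : L) := (J (2 * dotp v z + (r ^+ 2 - j%:R * (2 * r ^+ 2)))
  - J (2 * dotp v z + (r ^+ 2 - j.+1%:R * (2 * r ^+ 2))))%:E.
rewrite -[leRHS]/(\int[mu]_(z in [set z | (enorm z < 2 * r)%R]) f z)%E.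
have f0 z : (0 <= f z)%E.
  by rewrite lee_fin subr_ge0 ler_spow// -natr1; nra.
have mf : measurable_fun [set: L] f.
  apply/measurable_EFinP; apply: measurable_funB; exact: measurable_spow_dotp.
pose D : set L := sign_shift c 1 @^-1` [set z | enorm z < r].
have e1 : (1 : R) ^+ 2 = 1 by rewrite expr1n.
have mD : measurable D.
  rewrite -[X in measurable X]setTI; apply: measurable_sign_shift => //.
  exact: measurable_enorm_lt.
have cE : enorm c = j%:R * r ^+ 2 / enorm v.
  rewrite enormZ normrN ger0_norm; last by rewrite divr_ge0 ?mulr_ge0 ?sqr_ge0 ?exprn_ge0 ?enorm_ge0.
  by field; rewrite gt_eqF.
have c_le : enorm c <= r by rewrite cE ler_pdivrMr//; nra.
have dc : dotp v c = - (j%:R * r ^+ 2).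
  by rewrite dotpZr -sqr_enorm mulNr divfK// expf_neq0// gt_eqF.
apply: (@le_trans _ _ (\int[mu]_(z in D) f z)%E); last first.
  apply: ge0_subset_integral => //.
  - exact: measurable_enorm_lt.
  - exact: measurable_funTS.
  - move=> z; rewrite /D /= /sign_shift scale1r addrC => h.
    by have := ler_enormB z c; lra.
rewrite le_eqVlt; apply/orP; left; apply/eqP.
rewrite (ge0_integral_sign_shift (- c) e1 mD)//; last exact: measurable_funTS.
have -> : sign_shift (- c) 1 @^-1` D = [set z | enorm z < r].
  by apply/seteqP; split => z;
    rewrite /D /preimage/= /sign_shift !scale1r addrA subrr add0r.
apply: eq_integral => z _; rewrite /f /sign_shift scale1r dotpDr.
have -> : dotp v (- c) = j%:R * r ^+ 2.
  by rewrite -scaleN1r dotpZr dc mulN1r opprK.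
by congr (_%:E); congr (J _ - J _); rewrite -?natr1; lra.
Qed.

(* The [2 ^ k] translates of the left-hand side add up to a telescoping sum, hence
   the gain [2^-1 ^+ k], which replaces the derivative of [J]: the latter would be
   unbounded on [v.z = 0] when [p < 2]. *)
Lemma integral_spow_diff_ball v (k : nat) (r : R) :
  0 < enorm v -> r = enorm v * 2^-1 ^+ k ->
  (\int[mu]_(z in [set z | (enorm z < r)%R])
     (J (2 * dotp v z + r ^+ 2) - J (2 * dotp v z - r ^+ 2))%:E <=
   (2^-1 ^+ k * (2 * (6 * enorm v * r) `^ (p - 1) * (4 * r) ^+ n))%:E)%E.
Proof.
move=> v0 rE; have r0 : 0 < r by rewrite rE mulr_gt0 ?exprn_gt0.
have rv : (2 ^ k)%:R * r = enorm v.
  by rewrite rE natrX mulrCA -exprMn divff// expr1n mulr1.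
have rlev : r <= enorm v.
  by rewrite rE ler_piMr ?enorm_ge0//; apply: exprn_ile1; lra.
set I := (X in (X <= _)%E); set K := 2 * _ * _.
have K0 : 0 <= K by rewrite !mulr_ge0 ?powR_ge0 ?exprn_ge0//; lra.
suff h : ((2 ^ k)%:R%:E * I <= K%:E)%E.
  by rewrite EFinM exprVn -natrX lee_pdivlMl// ltr0n expn_gt0.
pose F j := fun z : L =>
  ((J (2 * dotp v z + (r ^+ 2 - j%:R * (2 * r ^+ 2)))
      - J (2 * dotp v z + (r ^+ 2 - j.+1%:R * (2 * r ^+ 2))))%:E)%E.
have F0 j z : (0 <= F j z)%E by rewrite lee_fin subr_ge0 ler_spow// -natr1; nra.
have mF j : measurable_fun [set: L] (F j).
  apply/measurable_EFinP; apply: measurable_funB; exact: measurable_spow_dotp.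
apply: (@le_trans _ _ (\sum_(0 <= j < 2 ^ k)
    \int[mu]_(z in [set z | (enorm z < 2 * r)%R]) F j z)%E).
  rewrite (_ : ((2 ^ k)%:R%:E * I)%E = (\sum_(0 <= j < 2 ^ k) I)%E); last first.
    by rewrite sumr_const_nat subn0 mule_natl.
  rewrite big_nat [X in (_ <= X)%E]big_nat; apply: lee_sum => j /= jk.
  apply: integral_spow_shift_le => //; first exact: ltW.
  by rewrite -rv ler_pM2r// ler_nat ltnW.
rewrite -ge0_integral_sum//; last 2 first.
- exact: measurable_enorm_lt.
- by move=> j; exact: measurable_funTS.
rewrite EFinM.
apply: (@le_trans _ _ ((2 * (6 * enorm v * r) `^ (p - 1))%:E *
    mu [set z | (enorm z < 2 * r)%R])%E); last first.
  rewrite lee_wpmul2l// ?lee_fin ?mulr_ge0 ?powR_ge0//.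
  by rewrite (_ : 4 * r = 2 * (2 * r)) ?lebesgue_ball_le//; lra.
apply: ge0_integral_le_bound.
- exact: measurable_enorm_lt.
- apply: measurable_funTS; exact: emeasurable_sum.
move=> z /= zr; rewrite sume_ge0//= sumEFin lee_fin.
under eq_bigr do rewrite -opprB.
rewrite sumrN telescope_sumr// opprB mul0r subr0.
have hz := normr_dotp_le v z; have ez := enorm_ge0 z.
have vz : `|dotp v z| <= enorm v * (2 * r).
  by apply: le_trans hz _; rewrite ler_pM2l// ltW.
move: vz; rewrite ler_norml => /andP[vz1 vz2].
have -> : (2 ^ k)%:R * (2 * r ^+ 2) = 2 * enorm v * r by rewrite -rv; ring.
have c0 : 0 <= 6 * enorm v * r by nra.
have h1 : J (2 * dotp v z + r ^+ 2) <= J (6 * enorm v * r) by apply: ler_spow => //; nra.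
have h2 : - J (6 * enorm v * r) <= J (2 * dotp v z + (r ^+ 2 - 2 * enorm v * r)).
  by rewrite -spowN; apply: ler_spow => //; nra.
by rewrite -(spow_ge0E p_gt1 c0); lra.
Qed.

End near_estimate.

Section near_integral.
Context {R : realType} {n : nat} (p sigma : R).
Hypotheses (p_gt1 : 1 < p) (sigma_gt0 : 0 < sigma) (sigma_ltp : sigma < p).
Local Notation L := (lebesgue_type R n).
Local Notation mu := (lebesgue_rV R n).
Implicit Types v z : 'rV[R]_n.
Local Notation J := (spow p).

Definition near_const : R :=
  2 * 8 ^+ n * 12 `^ (p - 1) * 2^-1 `^ (p - 1 - sigma) / (1 - 2^-1 `^ (p - sigma)).

Lemma near_const_ge0 : 0 <= near_const.
Proof.
rewrite divr_ge0 ?mulr_ge0 ?powR_ge0// subr_ge0 ltW// powR_lt1 ?subr_gt0//; lra.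
Qed.

Lemma measurable_near_integrand v :
  measurable_fun [set: L] (fun z : L =>
    (J (2 * dotp v z + enorm z ^+ 2) - J (2 * dotp v z - enorm z ^+ 2))
      / enorm z `^ (n%:R + sigma)).
Proof.
have m2 : measurable_fun [set: L] (fun z : L => enorm z ^+ 2).
  by apply: measurable_funX; exact: measurable_enorm.
apply: measurable_funM.
  apply: measurable_funB; first exact: measurable_spow_dotp.
  exact: measurable_spow_dotp (measurableT_comp (@oppr_measurable R _) m2).
under eq_fun do rewrite -powRN; exact: measurable_powR_enorm.
Qed.

Lemma integral_near_shell v (k : nat) (r0 : R) : r0 = enorm v / 2 * 2^-1 ^+ k ->
  0 < enorm v ->
  (\int[mu]_(z in shell r0)
    ((J (2 * dotp v z + enorm z ^+ 2) - J (2 * dotp v z - enorm z ^+ 2))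
      / enorm z `^ (n%:R + sigma))%:E <=
   ((r0 `^ (n%:R + sigma))^-1 *
     (2^-1 ^+ k * (2 * (6 * enorm v * (2 * r0)) `^ (p - 1) * (4 * (2 * r0)) ^+ n)))%:E)%E.
Proof.
move=> rE v0; have r_gt0 : 0 < r0 by rewrite rE !mulr_gt0 ?exprn_gt0.
pose g (z : L) := (J (2 * dotp v z + (2 * r0) ^+ 2) - J (2 * dotp v z - (2 * r0) ^+ 2))%:E.
have g0 z : (0 <= g z)%E by rewrite lee_fin subr_ge0 ler_spow//; nra.
have mg : measurable_fun [set: L] g.
  by apply/measurable_EFinP; apply: measurable_funB; exact: measurable_spow_dotp.
set w := (r0 `^ _)^-1; have w0 : 0 <= w by rewrite invr_ge0 powR_ge0.
apply: (@le_trans _ _ (\int[mu]_(z in shell r0) (w%:E * g z))%E).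
  apply: ge0_le_integral.
  - exact: measurable_shell.
  - move=> z _; rewrite lee_fin divr_ge0 ?powR_ge0// subr_ge0 ler_spow//.
    by have := sqr_ge0 (enorm z); lra.
  - by apply: measurable_funTS; apply/measurable_EFinP; exact: measurable_near_integrand.
  - by apply: measurable_funTS; apply: measurable_funeM.
  move=> z /andP[rz zr]; rewrite -EFinM lee_fin mulrC.
  have z2 : enorm z ^+ 2 <= (2 * r0) ^+ 2 by rewrite ler_pXn2r ?nnegrE ?enorm_ge0 ?(ltW zr)//; lra.
  have z0 := lt_le_trans r_gt0 rz.
  apply: ler_pM.
  - by rewrite invr_ge0 powR_ge0.
  - by rewrite subr_ge0 ler_spow//; have := sqr_ge0 (enorm z); lra.
  - rewrite lef_pV2 ?posrE ?powR_gt0//; apply: powR_le => //; last exact: ltW.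
    by rewrite addr_ge0 ?ler0n// ltW.
  - by apply: lerB; apply: ler_spow => //; lra.
rewrite ge0_integralZl_EFin//; last 2 first.
- exact: measurable_shell.
- exact: measurable_funTS.
rewrite EFinM lee_wpmul2l ?lee_fin//.
have r2 : 2 * r0 = enorm v * 2^-1 ^+ k by rewrite rE; field.
apply: le_trans (integral_spow_diff_ball p_gt1 v0 r2).
apply: ge0_subset_integral => //.
- exact: measurable_shell.
- exact: measurable_enorm_lt.
- exact: measurable_funTS.
- exact: shell_subset_ball.
Qed.

Lemma integral_near v (D : set L) : 0 < enorm v -> measurable D ->
  D `<=` [set z | 0 < enorm z < enorm v] ->
  (\int[mu]_(z in D)
    ((J (2 * dotp v z + enorm z ^+ 2) - J (2 * dotp v z - enorm z ^+ 2))
      / enorm z `^ (n%:R + sigma))%:E <=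
   (near_const * enorm v `^ (2 * (p - 1) - sigma))%:E)%E.
Proof.
move=> v0 mD Dv; set d := enorm v.
pose c := 2 * 8 ^+ n * (12 * d) `^ (p - 1) * (d / 2) `^ (p - 1 - sigma).
have q1 : 2^-1 `^ (p - sigma) < 1 by apply: powR_lt1; rewrite ?subr_gt0//; lra.
apply: (@le_trans _ _ (c / (1 - 2^-1 `^ (p - sigma)))%:E).
  apply: (integral_bigcup_geometric (F := fun k => shell (d / 2 * 2^-1 ^+ k))).
  - by move=> k; exact: measurable_shell.
  - by apply: trivIset_shell_in; rewrite divr_gt0.
  - exact: mD.
  - by apply: subset_trans Dv _; exact: shell_in_cover.
  - by apply/measurable_EFinP; exact: measurable_near_integrand.
  - move=> z; rewrite lee_fin divr_ge0 ?powR_ge0// subr_ge0 ler_spow//.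
    by have := sqr_ge0 (enorm z); lra.
  - by rewrite /c !mulr_ge0 ?powR_ge0 ?exprn_ge0.
  - by rewrite powR_gt0//= q1.
  move=> k; apply: le_trans (integral_near_shell _ v0) _; first by [].
  rewrite lee_fin le_eqVlt; apply/orP; left; apply/eqP.
  set r0 := d / 2 * 2^-1 ^+ k.
  have r_gt0 : 0 < r0 by rewrite !mulr_gt0 ?exprn_gt0.
  have -> : 2^-1 `^ (p - sigma) ^+ k = 2^-1 ^+ k * (2^-1 ^+ k) `^ (p - 1 - sigma).
    rewrite -powR_expr// -[X in X * _]powRr1 ?exprn_ge0// -powR_add ?exprn_gt0//.
    by congr powR; lra.
  have -> : 6 * enorm v * (2 * r0) = (12 * d) * r0 by rewrite -/d; ring.
  have d12 : 0 <= 12 * d by rewrite mulr_ge0 ?enorm_ge0.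
  rewrite powRM//; last exact: ltW.
  have -> : (4 * (2 * r0)) ^+ n = 8 ^+ n * r0 `^ n%:R.
    by rewrite powR_mulrn -?exprMn ?(ltW r_gt0)//; congr (_ ^+ _); ring.
  have E : r0 `^ (p - 1) * r0 `^ n%:R = r0 `^ (n%:R + sigma) * r0 `^ (p - 1 - sigma).
    by rewrite -!powR_add//; congr powR; ring.
  have E2 : r0 `^ (p - 1 - sigma) = (d / 2) `^ (p - 1 - sigma) * (2^-1 ^+ k) `^ (p - 1 - sigma).
    by rewrite -powRM ?exprn_ge0 ?divr_ge0 ?enorm_ge0.
  have w0 : r0 `^ (n%:R + sigma) != 0 by rewrite gt_eqF// powR_gt0.
  transitivity ((r0 `^ (n%:R + sigma))^-1 * (2^-1 ^+ k * (2 * (12 * d) `^ (p - 1) * 8 ^+ n)) *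
    (r0 `^ (p - 1) * r0 `^ n%:R)); first by ring.
  rewrite E E2 /c; by field.
rewrite lee_fin le_eqVlt; apply/orP; left; apply/eqP; rewrite /c /near_const.
have -> : d `^ (2 * (p - 1) - sigma) = d `^ (p - 1) * d `^ (p - 1 - sigma).
  by rewrite -powR_add//; congr powR; ring.
have q0 : 1 - 2^-1 `^ (p - sigma) != 0 by rewrite gt_eqF// subr_gt0.
rewrite (powRM _ _ (ltW v0))// (powRM _ (ltW v0))//; lra.
Qed.

End near_integral.

Arguments near_const {R} n p sigma.

Section integral_bounds.
Context {R : realType} {n : nat}.
Local Notation L := (lebesgue_type R n).
Local Notation mu := (lebesgue_rV R n).

Lemma integral_sign_shift (c : 'rV[R]_n) (e : R) (D : set L)
    (f : L -> \bar R) : e ^+ 2 = 1 -> measurable D -> measurable_fun D f ->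
  (\int[mu]_(x in D) f x =
   \int[mu]_(x in sign_shift c e @^-1` D) f (sign_shift c e x))%E.
Proof.
move=> e1 mD mf; rewrite integralE [RHS]integralE.
congr (_ - _)%E.
  rewrite (ge0_integral_sign_shift c e1 mD (measurable_funepos mf))//.
  by apply: eq_integral => x _; rewrite !funeposE.
rewrite (ge0_integral_sign_shift c e1 mD (measurable_funeneg mf))//.
by apply: eq_integral => x _; rewrite !funenegE.
Qed.

Lemma integral_ge_opp (D : set L) (F G : L -> R) : measurable D ->
  measurable_fun D F -> measurable_fun D G -> (forall z, D z -> 0 <= G z) ->
  (forall z, D z -> - G z <= F z) ->
  (- (\int[mu]_(z in D) (G z)%:E) <= \int[mu]_(z in D) (F z)%:E)%E.
Proof.
move=> mD mF mG G0 FG; rewrite [X in (_ <= X)%E]integralE -[X in (X <= _)%E]add0e.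
apply: leeB; first by apply: integral_ge0 => z _; exact: funepos_ge0.
apply: (ge0_le_integral mu mD).
- by move=> z _; exact: funeneg_ge0.
- by apply: measurable_funeneg; apply/measurable_EFinP; exact: mF.
- by apply/measurable_EFinP; exact: mG.
move=> z Dz; rewrite funenegE -EFinN -EFin_max lee_fin ge_max G0// andbT.
by rewrite lerNl FG.
Qed.

End integral_bounds.

Section near_lower_bound.
Context {R : realType} {n : nat} (p sigma : R).
Hypotheses (p_gt1 : 1 < p) (sigma_gt0 : 0 < sigma) (sigma_ltp : sigma < p).
Local Notation L := (lebesgue_type R n).
Local Notation mu := (lebesgue_rV R n).
Implicit Types v z : 'rV[R]_n.
Local Notation J := (spow p).

Lemma measurable_kernel (f : L -> R) (D : set L) (a : R) : measurable_fun D f ->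
  measurable_fun D (fun z : L => f z / enorm z `^ a).
Proof.
move=> mf.
have mk : measurable_fun [set: L] (fun z : L => (enorm z `^ a)^-1).
  by under eq_fun do rewrite -powRN; exact: measurable_powR_enorm.
exact: measurable_funM mf (measurable_funTS mk).
Qed.

Lemma measurable_enorm_co (a b : R) : measurable ([set z | a <= enorm z < b] : set L).
Proof.
rewrite (_ : mkset _ = [set z | a <= enorm z] `&` [set z | enorm z < b]).
  by apply: measurableI; [exact: measurable_enorm_ge|exact: measurable_enorm_lt].
by apply/seteqP; split => z /= => [/andP[]|[? ?]] //; apply/andP.
Qed.

(* Symmetrizing [z <-> - z] leaves half of the difference bounded by [integral_near]. *)
Lemma integral_paraboloid_le v (eps : R) : 0 < eps -> 0 < enorm v ->
  let f z := J (2 * dotp v z + enorm z ^+ 2) / enorm z `^ (n%:R + sigma) in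
  let N := [set z : L | eps <= enorm z < enorm v] in
  mu.-integrable N (EFin \o f) /\
  (\int[mu]_(z in N) (f z)%:E <=
    (near_const n p sigma * enorm v `^ (2 * (p - 1) - sigma))%:E)%E.
Proof.
move=> e0 v0 f N; have mN : measurable N := measurable_enorm_co eps (enorm v).
have mf : measurable_fun [set: L] f.
  apply: measurable_kernel; apply: measurable_spow_dotp.
  by apply: measurable_funX; exact: measurable_enorm.
have intf : mu.-integrable N (EFin \o f).
  apply: measurable_bounded_integrable => //.
  - apply: le_lt_trans (ltry ((2 * enorm v) ^+ n)).
    apply: le_trans (lebesgue_ball_le (ltW v0)); apply: le_measure; rewrite ?inE//.
      exact: measurable_enorm_lt.
    by move=> z /andP[].
  - exact: measurable_funTS.
  exists (J (3 * enorm v ^+ 2) / eps `^ (n%:R + sigma)); split; first exact: num_real.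
  move=> M hM z /andP[ze zv]; apply: le_trans (ltW hM).
  have z0 := lt_le_trans e0 ze.
  rewrite /f normrM [X in _ * X]ger0_norm ?invr_ge0 ?powR_ge0//.
  have := normr_dotp_le v z; rewrite ler_norml => /andP[h1 h2].
  apply: ler_pM => //.
  - by rewrite invr_ge0 powR_ge0.
  - by rewrite ler_norml -spowN !ler_spow//; nra.
  - rewrite lef_pV2 ?posrE ?powR_gt0//; apply: powR_le => //; last exact: ltW.
    by rewrite addr_ge0 ?ler0n// ltW.
split => //; set I := (X in (X <= _)%E).
have IE : I = (\int[mu]_(z in N) (f (- z))%:E)%E.
  have e1 : (-1 : R) ^+ 2 = 1 by rewrite sqrrN expr1n.
  rewrite /I (integral_sign_shift 0 e1 mN); last exact/measurable_EFinP/measurable_funTS.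
  have -> : sign_shift 0 (-1) @^-1` N = N.
    by apply/seteqP; split => z; rewrite /N/preimage/= /sign_shift add0r scaleN1r enormN.
  by apply: eq_integral => z _; rewrite /sign_shift add0r scaleN1r.
have mfN : measurable_fun [set: L] (fun z : L => f (- z)).
  apply: eq_measurable_fun (measurableT_comp mf (@measurable_sign_shift R n 0 (-1) _)).
    by move=> z _ /=; rewrite /sign_shift add0r scaleN1r.
  by rewrite sqrrN expr1n.
have Ifin : I \is a fin_num by exact: integrable_fin_num.
have Jfin : (\int[mu]_(z in N) (f (- z))%:E)%E \is a fin_num by rewrite -IE.
have II : (I + I <= (near_const n p sigma * enorm v `^ (2 * (p - 1) - sigma))%:E)%E.
  have intg : mu.-integrable N (EFin \o (fun z : L => f (- z))).
    apply/integrableP; split; first exact/measurable_EFinP/measurable_funTS.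
    by move: Jfin; rewrite -(integral_fin_num_abs mu mN (measurable_funTS mfN)).
  have -> : (I + I)%E = (\int[mu]_(z in N) ((f z)%:E + (f (- z))%:E))%E.
    by rewrite [RHS](integralD mN intf intg) -IE.
  apply: le_trans (integral_near p_gt1 sigma_gt0 sigma_ltp v0 mN _).
    rewrite le_eqVlt; apply/orP; left; apply/eqP; apply: eq_integral => z _.
    rewrite -EFinD /f enormN -mulrDl -(scaleN1r z) dotpZr mulN1r mulrN.
    have -> : - (2 * dotp v z) + enorm z ^+ 2 = - (2 * dotp v z - enorm z ^+ 2) by ring.
    by rewrite spowN.
  by move=> z /andP[h1 h2]; apply/andP; split; [exact: lt_le_trans e0 h1|exact: h2].
have K0 : 0 <= near_const n p sigma * enorm v `^ (2 * (p - 1) - sigma).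
  by rewrite mulr_ge0 ?powR_ge0 ?near_const_ge0.
move: II; rewrite -(fineK Ifin) -EFinD !lee_fin; lra.
Qed.

Lemma integral_paraboloid_ge v (eps k : R) : 0 < eps -> 0 < enorm v -> 0 <= k ->
  (- (k `^ (p - 1) * (near_const n p sigma * enorm v `^ (2 * (p - 1) - sigma)))%:E <=
   \int[mu]_(z in [set z : L | (eps <= enorm z < enorm v)%R])
     (J (- (k * (2 * dotp v z + enorm z ^+ 2))) / enorm z `^ (n%:R + sigma))%:E)%E.
Proof.
move=> e0 v0 k0; have [intf If] := integral_paraboloid_le e0 v0.
set N := [set z : L | _].
have -> : (\int[mu]_(z in N)
     (J (- (k * (2 * dotp v z + enorm z ^+ 2))) / enorm z `^ (n%:R + sigma))%:E =
   \int[mu]_(z in N) ((- k `^ (p - 1))%:E *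
    (J (2 * dotp v z + enorm z ^+ 2) / enorm z `^ (n%:R + sigma))%:E))%E.
  apply: eq_integral => z _.
  by rewrite -EFinM spowN spowM//; congr EFin; ring.
have mN : measurable N := measurable_enorm_co eps (enorm v).
rewrite (integralZl mN intf) EFinN mulNe leeN2 EFinM.
by apply: lee_wpmul2l => //; rewrite lee_fin powR_ge0.
Qed.

End near_lower_bound.

Section truncated_lower_bound.
Context {R : realType} {n : nat} (p sigma : R).
Hypotheses (p_gt1 : 1 < p) (sigma_gt0 : 0 < sigma) (sigma_ltp : sigma < p).
Local Notation L := (lebesgue_type R n).
Local Notation mu := (lebesgue_rV R n).
Implicit Types v z : 'rV[R]_n.
Local Notation J := (spow p).

Lemma measurable_cstM (D : set L) (a : R) (f : L -> R) : measurable_fun D f ->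
  measurable_fun D (fun z => a * f z).
Proof. by move=> mf; exact: (measurable_funM (measurable_cst a) mf). Qed.

Lemma ge0_integral_cstM (D : set L) (a : R) (f : L -> R) : measurable D ->
  measurable_fun setT f -> (forall z, 0 <= f z) -> 0 <= a ->
  (\int[mu]_(z in D) (a * f z)%:E = a%:E * \int[mu]_(z in D) (f z)%:E)%E.
Proof.
move=> mD mf f0 a0; under eq_integral do rewrite EFinM.
apply: (ge0_integralZl_EFin mu mD) => [z _||]; last exact: a0.
  by rewrite lee_fin.
by apply: measurable_funTS; apply/measurable_EFinP; exact: mf.
Qed.

Lemma ge0_integral_add (D : set L) (f g : L -> R) : measurable D ->
  measurable_fun setT f -> measurable_fun setT g ->
  (forall z, 0 <= f z) -> (forall z, 0 <= g z) ->
  (\int[mu]_(z in D) (f z + g z)%:E =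
   \int[mu]_(z in D) (f z)%:E + \int[mu]_(z in D) (g z)%:E)%E.
Proof.
move=> mD mf mg f0 g0; under eq_integral do rewrite EFinD.
apply: (ge0_integralD mu mD).
- by move=> z _; rewrite lee_fin.
- by apply: measurable_funTS; exact/measurable_EFinP.
- by move=> z _; rewrite lee_fin.
- by apply: measurable_funTS; exact/measurable_EFinP.
Qed.

Lemma powR_add_le (a x y : R) : 0 <= a -> 0 <= x -> 0 <= y ->
  (x + y) `^ a <= 2 `^ a * (x `^ a + y `^ a).
Proof.
move=> a0; wlog xy : x y / x <= y => [H x0 y0|x0 y0].
  have [xy|/ltW yx] := leP x y; first exact: H.
  by rewrite addrC [X in _ * X]addrC; exact: H.
apply: (@le_trans _ _ ((2 * y) `^ a)).
  by apply: powR_le => //; [rewrite addr_ge0|lra].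
by rewrite powRM// ler_pM2l ?powR_gt0// lerDr powR_ge0.
Qed.

Lemma integral_kernel_far (r : R) : 0 < r ->
  (\int[mu]_(z in [set z : L | (r <= enorm z)%R]) (enorm z `^ (- sigma - n%:R))%:E <=
    (shell_const (n := n) (- sigma) / (1 - 2 `^ (- sigma)) * r `^ (- sigma))%:E)%E.
Proof. by move=> r0; apply: integral_powR_out => //; rewrite oppr_lt0. Qed.

Lemma truncated_ge v (delta g : L -> R) (eps k rho c gamma M S T : R) :
  measurable_fun setT delta -> measurable_fun setT g ->
  (forall z, 0 <= g z) -> 0 < eps -> eps < enorm v -> enorm v < rho ->
  0 <= k -> 0 <= c -> 0 <= M ->
  (forall z, enorm z < enorm v -> delta z = - (k * (2 * dotp v z + enorm z ^+ 2))) ->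
  (forall z, enorm v <= enorm z < rho -> - (c * enorm z `^ gamma) <= delta z) ->
  (forall z, rho <= enorm z -> - (M + g z) <= delta z) ->
  (\int[mu]_(z in [set z : L | (enorm v <= enorm z < rho)%R])
      (enorm z `^ (gamma * (p - 1) - sigma - n%:R))%:E <= S%:E)%E ->
  (\int[mu]_(z in [set z : L | (rho <= enorm z)%R])
      (g z `^ (p - 1) / enorm z `^ (n%:R + sigma))%:E <= T%:E)%E ->
  (- (k `^ (p - 1) * (near_const n p sigma * enorm v `^ (2 * (p - 1) - sigma))
      + c `^ (p - 1) * S
      + 2 `^ (p - 1) * (M `^ (p - 1) *
          (shell_const (n := n) (- sigma) / (1 - 2 `^ (- sigma)) * rho `^ (- sigma)) + T))%:E
   <= \int[mu]_(z in [set z : L | (eps <= enorm z)%R])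
        (J (delta z) / enorm z `^ (n%:R + sigma))%:E)%E.
Proof.
move=> md mg g0 e0 ev vr k0 c0 M0 h1 h2 h3 hS hT.
have v0 := lt_trans e0 ev; have r0 := lt_trans v0 vr.
have p0 : 0 <= p - 1 by rewrite subr_ge0 ltW.
set N := [set z : L | eps <= enorm z < enorm v].
set O1 := [set z : L | enorm v <= enorm z < rho].
set O2 := [set z : L | rho <= enorm z].
have mN : measurable N := measurable_enorm_co eps (enorm v).
have mO1 : measurable O1 := measurable_enorm_co (enorm v) rho.
have mO2 : measurable O2 := measurable_enorm_ge rho.
have -> : [set z : L | eps <= enorm z] = N `|` (O1 `|` O2).
  apply/seteqP; split => z; rewrite /N /O1 /O2 /=.
    move=> ez; have [zv|vz] := ltP (enorm z) (enorm v); first by left; rewrite ez.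
    by right; have [zr|rz] := ltP (enorm z) rho; [left|right].
  by move=> [/andP[]//|[/andP[+ _]|]]; lra.
have mF : measurable_fun [set: L] (fun z : L => J (delta z) / enorm z `^ (n%:R + sigma)).
  by apply: measurable_kernel; exact: measurableT_comp (measurable_spow p) md.
have mFE : measurable_fun [set: L] (fun z : L => (J (delta z) / enorm z `^ (n%:R + sigma))%:E).
  exact/measurable_EFinP.
have dN : [disjoint N & O1 `|` O2].
  apply/disj_setPS => z [/andP[_ h] [/andP[h' _]|h']].
    by have := lt_le_trans h h'; rewrite ltxx.
  by have := lt_trans vr (le_lt_trans h' h); rewrite ltxx.
have dO : [disjoint O1 & O2].
  by apply/disj_setPS => z [/andP[_ h] h']; have := lt_le_trans h h'; rewrite ltxx.
rewrite (integral_setU mu mN (measurableU _ _ mO1 mO2) (measurable_funTS mFE) dN).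
rewrite (integral_setU mu mO1 mO2 (measurable_funTS mFE) dO).
rewrite -EFinN opprD opprD EFinD EFinD -addeA; apply: leeD; last apply: leeD.
- apply: le_trans (integral_paraboloid_ge p_gt1 sigma_gt0 sigma_ltp e0 v0 k0) _.
  rewrite le_eqVlt; apply/orP; left; apply/eqP; apply: eq_integral => z.
  by rewrite inE /= => /andP[_ zv]; rewrite h1.
- pose G (z : L) := c `^ (p - 1) * enorm z `^ (gamma * (p - 1) - sigma - n%:R).
  have mG : measurable_fun [set: L] G.
    exact: measurable_cstM (measurable_powR_enorm _).
  apply: (@le_trans _ _ (- \int[mu]_(z in O1) (G z)%:E)%E).
    rewrite EFinN leeN2 /G.
    rewrite (ge0_integral_cstM mO1 (measurable_powR_enorm _))//; last first.
    - exact: powR_ge0.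
    - by move=> z; exact: powR_ge0.
    rewrite EFinM; apply: lee_wpmul2l; last exact: hS.
    by rewrite lee_fin powR_ge0.
  apply: (integral_ge_opp _ (measurable_funTS mF) (measurable_funTS mG)) => //.
    by move=> z _; rewrite mulr_ge0 ?powR_ge0.
  move=> z zO; have /andP[vz _] := zO; have z0 := lt_le_trans v0 vz.
  have -> : G z = (c * enorm z `^ gamma) `^ (p - 1) / enorm z `^ (n%:R + sigma).
    rewrite powRM ?powR_ge0// -powRrM -mulrA -powRN -powR_add// /G.
    by congr (_ * _ `^ _); ring.
  rewrite -mulNr -spow_ge0E ?mulr_ge0 ?powR_ge0// -spowN.
  by rewrite ler_pM2r ?invr_gt0 ?powR_gt0// ler_spow// h2.
- pose G1 (z : L) := enorm z `^ (- sigma - n%:R).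
  pose G2 (z : L) := g z `^ (p - 1) / enorm z `^ (n%:R + sigma).
  have mG1 : measurable_fun [set: L] G1 by exact: measurable_powR_enorm.
  have mG2 : measurable_fun [set: L] G2.
    by apply: measurable_kernel; exact: measurableT_comp (measurable_powR _) mg.
  have G10 z : 0 <= G1 z by exact: powR_ge0.
  have G20 z : 0 <= G2 z by rewrite divr_ge0 ?powR_ge0.
  pose G z := 2 `^ (p - 1) * (M `^ (p - 1) * G1 z + G2 z).
  have mG : measurable_fun [set: L] G.
    exact: measurable_cstM (measurable_funD (measurable_cstM _ mG1) mG2).
  apply: (@le_trans _ _ (- \int[mu]_(z in O2) (G z)%:E)%E).
    rewrite EFinN leeN2 /G.
    have mMG := measurable_cstM (M `^ (p - 1)) mG1.
    have MG0 z : 0 <= M `^ (p - 1) * G1 z by rewrite mulr_ge0 ?powR_ge0.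
    rewrite (ge0_integral_cstM mO2 (measurable_funD mMG mG2)); first last.
    - exact: powR_ge0.
    - by move=> z; rewrite addr_ge0.
    rewrite EFinM; apply: lee_wpmul2l; first by rewrite lee_fin powR_ge0.
    rewrite (ge0_integral_add mO2 mMG mG2 MG0 G20) EFinD; apply: leeD; last exact: hT.
    rewrite (ge0_integral_cstM mO2 mG1 G10 (powR_ge0 _ _)) EFinM.
    by apply: lee_wpmul2l; [rewrite lee_fin powR_ge0|exact: integral_kernel_far].
  apply: (integral_ge_opp _ (measurable_funTS mF) (measurable_funTS mG)) => //.
    by move=> z _; rewrite mulr_ge0 ?powR_ge0// addr_ge0// mulr_ge0 ?powR_ge0.
  move=> z rz; have z0 := lt_le_trans r0 rz.
  have -> : G z = (2 `^ (p - 1) * (M `^ (p - 1) + g z `^ (p - 1))) / enorm z `^ (n%:R + sigma).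
    rewrite /G /G1 /G2 (_ : - sigma - n%:R = - (n%:R + sigma)); last by ring.
    by rewrite powRN; ring.
  rewrite -mulNr ler_pM2r ?invr_gt0 ?powR_gt0//.
  apply: (@le_trans _ _ (- J (M + g z))).
    by rewrite lerN2 spow_ge0E ?addr_ge0// powR_add_le.
  by rewrite -spowN ler_spow// h3.
Qed.

End truncated_lower_bound.

(** * Paraboloids as test functions *)

Section power_inequalities.
Context {R : realType}.

Lemma powR_subadd (g x y : R) : 0 < g <= 1 -> 0 <= x -> 0 <= y ->
  (x + y) `^ g <= x `^ g + y `^ g.
Proof.
move=> /andP[g0 g1] x0 y0; have [->|xy0] := eqVneq (x + y) 0.
  by rewrite powR0 ?gt_eqF// addr_ge0 ?powR_ge0.
have s0 : 0 < x + y by rewrite lt0r xy0 addr_ge0.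
have H z : 0 <= z -> z <= x + y -> z / (x + y) * (x + y) `^ g <= z `^ g.
  move=> z0 zs; have [->|z0'] := eqVneq z 0; first by rewrite !mul0r powR_ge0.
  have zp : 0 < z by rewrite lt0r z0'.
  rewrite -{2}(divfK xy0 z) powRM ?divr_ge0 ?addr_ge0// ler_pM2r ?powR_gt0//.
  by apply: ger1_powR => //; rewrite divr_gt0//= ler_pdivrMr// mul1r.
have hx := H x x0 (_ : x <= x + y); have hy := H y y0 (_ : y <= x + y).
have := lerD (hx _) (hy _); rewrite -mulrDl -mulrDl divff// mul1r; apply; lra.
Qed.

Lemma powR_bernoulli (g x : R) : 0 < g <= 1 -> 0 <= x -> x `^ g <= 1 + g * (x - 1).
Proof.
move=> /andP[g0 g1] x0; have [->|gn1] := eqVneq g 1; first by rewrite powRr1//; lra.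
have g1' : 0 < 1 - g by rewrite subr_gt0 lt_neqAle gn1.
have := @conjugate_powR R (x `^ g) 1 (g^-1) ((1 - g)^-1) (powR_ge0 _ _) ler01.
rewrite !invr_gt0 !invrK => /(_ g0 g1' _).
rewrite -powRrM divff ?gt_eqF// powRr1// powR1l mulr1 mul1r.
by move=> h; apply: le_trans (h _) _; lra.
Qed.

Lemma powR_le_paraboloid (g d w : R) : 0 < g <= 1 -> 0 < d -> 0 <= w ->
  w `^ g - d `^ g <= g * d `^ (g - 2) / 2 * (w ^+ 2 - d ^+ 2).
Proof.
move=> g01 d0 w0; have /andP[g0 _] := g01.
have h := powR_bernoulli g01 (divr_ge0 w0 (ltW d0)).
have dg : 0 < d `^ g by rewrite powR_gt0.
have dg2 : d `^ g = d `^ (g - 2) * d ^+ 2.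
  by rewrite -powR_mulrn ?(ltW d0)// -powR_add//; congr powR; lra.
have -> : w `^ g = d `^ g * (w / d) `^ g.
  by rewrite -powRM ?divr_ge0 ?(ltW d0)//; congr powR; field; rewrite gt_eqF.
apply: (@le_trans _ _ (d `^ g * (g * (w / d - 1)))).
  by rewrite -[X in _ - X]mulr1 -mulrBr ler_pM2l//; lra.
rewrite dg2; set t := w / d; have wE : w = t * d by rewrite /t divfK// gt_eqF.
have : 0 <= g * d `^ (g - 2) * d ^+ 2 * (t - 1) ^+ 2.
  by apply: mulr_ge0; rewrite ?sqr_ge0// !mulr_ge0 ?powR_ge0 ?exprn_ge0//; exact: ltW.
have -> : w ^+ 2 = (t * d) ^+ 2 by rewrite -wE.
set e := d `^ (g - 2); nra.
Qed.

End power_inequalities.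

Section paraboloid.
Context {R : realType} {n : nat}.
Implicit Types x y w v : 'rV[R]_n.

Lemma is_derive_quadratic (f : 'rV[R]_n -> R) x v (a b : R) :
  (forall h : R, f (h *: v + x) - f x = h * a + h ^+ 2 * b) -> is_derive x v f a.
Proof.
move=> fE.
have H : h^-1 *: ((f \o shift x) (h *: v) - f x) @[h --> 0^'] --> a.
  have E : {near 0^', (fun h : R => a + h * b) =1
      (fun h : R => h^-1 *: ((f \o shift x) (h *: v) - f x))}.
    near=> h; have h0 : h != 0 by near: h; exact: nbhs_dnbhs_neq.
    rewrite /= fE /GRing.scale /=; field; exact: h0.
  apply: cvg_trans; first exact: (near_eq_cvg E).
  have C' : a + h * b @[h --> (0 : R)] --> a.
    have C : a + h * b @[h --> (0 : R)] --> a + 0 * b.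
      exact: (cvgD (cvg_cst a) (cvgM cvg_id (cvg_cst b))).
    by rewrite mul0r addr0 in C.
  by move=> A /C'; exact: nbhs_dnbhs.
apply: DeriveDef; first by apply/cvg_ex; exists a; exact: H.
by rewrite /derive; exact: cvg_lim H.
Unshelve. all: by end_near. Qed.

Definition paraboloid (c k : R) w x : R := c + k * enorm (x - w) ^+ 2.

Lemma dotp_delta x (i : 'I_n) : dotp (delta_mx ord0 i) x = x ord0 i.
Proof.
rewrite /dotp (bigD1 i)//= mxE !eqxx mul1r big1 ?addr0// => j ji.
by rewrite mxE (negbTE ji) andbF mul0r.
Qed.

Lemma is_derive_paraboloid c k w x v :
  is_derive x v (paraboloid c k w) (2 * k * dotp v (x - w)).
Proof.
apply: (@is_derive_quadratic _ _ _ _ (k * enorm v ^+ 2)) => h.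
rewrite /paraboloid -(addrA (h *: v)) (sqr_enormD (h *: v)) enormZ dotpZl exprMn -normrX.
by rewrite (ger0_norm (sqr_ge0 h)); ring.
Qed.

Lemma partial_paraboloid c k w i :
  partial i (paraboloid c k w) = (fun x => 2 * k * (x - w) ord0 i).
Proof.
apply/funext => x; rewrite /partial.
by have /@derive_val -> := is_derive_paraboloid c k w x (delta_mx ord0 i);
  rewrite dotp_delta.
Qed.

Lemma grad_paraboloid c k w x :
  grad (paraboloid c k w) x = (2 * k) *: (x - w).
Proof. by apply/rowP => i; rewrite !mxE partial_paraboloid !mxE. Qed.

Lemma is_derive_affine k w i x v :
  is_derive x v (fun x => 2 * k * (x - w) ord0 i) (2 * k * v ord0 i).
Proof.
by apply: (@is_derive_quadratic _ _ _ _ 0) => h; rewrite !mxE; ring.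
Qed.

Lemma C2_paraboloid c k w (D : set 'rV[R]_n) : C2 D (paraboloid c k w).
Proof.
have cB : continuous (fun x => x - w : 'rV[R]_n).
  move=> y; apply: (@continuousD _ _ _ id (cst (- w))); first exact: cvg_id.
  exact: cst_continuous.
have cE : continuous (fun x => enorm (x - w)).
  by move=> y; apply: continuous_comp; [exact: cB|exact: continuous_enorm].
move=> x _; split.
- rewrite (_ : paraboloid c k w = fun x => c + k * (enorm (x - w) * enorm (x - w))).
    exact: (cvgD (cvg_cst c) (cvgM (cvg_cst k) (cvgM (cE x) (cE x)))).
  by apply/funext => y; rewrite /paraboloid expr2.
- move=> i; split.
    by have /@ex_derive := is_derive_paraboloid c k w x (delta_mx ord0 i).
  rewrite partial_paraboloid.
  have cc : {for x, continuous (fun x => (x - w) ord0 i)}.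
    have -> : (fun x => (x - w) ord0 i) = (fun x => x ord0 i - w ord0 i).
      by apply/funext => y; rewrite !mxE.
    exact: (cvgB (@continuous_coord _ _ i x) (cvg_cst _)).
  exact: (cvgM (cvg_cst (2 * k)) cc).
- move=> i j; rewrite partial_paraboloid; split.
    by have /@ex_derive := is_derive_affine k w i x (delta_mx ord0 j).
  rewrite (_ : partial j _ = cst (2 * k * (delta_mx ord0 j : 'rV[R]_n) ord0 i)).
    exact: cst_continuous.
  apply/funext => y; rewrite /partial.
  by have /@derive_val -> := is_derive_affine k w i y (delta_mx ord0 j).
Qed.

Lemma near_eball x (r : R) : 0 < r -> \forall y \near x, eball x r y.
Proof.
move=> r0; have c : {for x, continuous (fun y => enorm (y - x))}.
  apply: (@continuous_comp _ _ _ (fun y => y - x) enorm).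
    apply: (@continuousD _ _ _ id (cst (- x))); first exact: cvg_id.
    exact: cst_continuous.
  exact: continuous_enorm.
have := cvgr_lt _ c; rewrite subrr enorm0 => /(_ (nbhs_filter x) r r0); exact.
Qed.

Lemma grad_test_replace (phi u : 'rV[R]_n -> R) x (r : R) : 0 < r ->
  grad (test_replace (eball x r) phi u) x = grad phi x.
Proof.
move=> r0; apply/rowP => i; rewrite !mxE; apply: near_eq_derive.
apply: filterS (near_eball x r0) => y yr.
by rewrite /test_replace mem_set.
Qed.

End paraboloid.

(** * The inequality at a touching point *)

Lemma concave_touching_step (R : realFieldType) (A B q X e U V c g : R) :
  c * (A - B) <= c * (g * q / 2 * (X - e)) -> U - c * A <= V - c * B ->
  U <= V - c * g * q / 2 * e + c * g * q / 2 * X.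
Proof. by move=> h1 h2; lra. Qed.

Lemma hoelder_touching_step (R : realFieldType) (A B X U V c : R) :
  0 < c -> A <= B + X -> U - c * A <= V - c * B -> - (c * X) <= V - U.
Proof. by move=> c0; rewrite -(ler_pM2l c0) => h1 h2; lra. Qed.

Lemma translated_kernel_le (R : realType) (a x y : R) : 0 <= a -> 0 < y -> y / 4 <= x ->
  (x `^ a)^-1 <= 4 `^ a / y `^ a.
Proof.
move=> a0 y0 yx; have y40 : 0 < y / 4 by rewrite divr_gt0.
have x0 := lt_le_trans y40 yx.
have -> : y `^ a = 4 `^ a * (y / 4) `^ a.
  by rewrite -powRM ?(ltW y40)//; congr powR; field.
rewrite invfM mulrA divff ?gt_eqF ?powR_gt0// mul1r lef_pV2 ?posrE ?powR_gt0//.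
by apply: powR_le => //; exact: ltW.
Qed.

Section touching_point.
Context {R : realType} {n : nat}.
Local Notation L := (lebesgue_type R n).
Local Notation mu := (lebesgue_rV R n).

Lemma measurable_translate (T : L -> R) (x : 'rV[R]_n) : measurable_fun [set: L] T ->
  measurable_fun [set: L] (fun z : L => T (x + z)).
Proof.
move=> mT; have e1 : (1 : R) ^+ 2 = 1 by rewrite expr1n.
have -> : (fun z : L => T (x + z)) = T \o (sign_shift x 1 : L -> L).
  by apply/funext => z; rewrite /= /sign_shift scale1r.
exact: measurableT_comp mT (measurable_sign_shift x e1).
Qed.

(* Measures the part of [u] seen only through its tail; [u] is bounded on [eball 0 2]. *)
Definition exterior (u : 'rV[R]_n -> R) (z : 'rV[R]_n) : R :=
  if 2 <= enorm z then `|u z| else 0.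

Lemma exterior_ge0 u z : 0 <= exterior u z.
Proof. by rewrite /exterior; case: ifP. Qed.

Lemma measurable_exterior u : measurable_fun [set: L] (u : L -> R) ->
  measurable_fun [set: L] (exterior u : L -> R).
Proof.
move=> mu'; apply: measurable_fun_ifT.
- exact: measurable_fun_ler (measurable_cst _) measurable_enorm.
- exact: measurableT_comp (@normr_measurable R _) mu'.
- exact: measurable_cst.
Qed.

Lemma integral_exterior_translate (p sigma : R) (u : 'rV[R]_n -> R) (y : 'rV[R]_n) (rho T : R) :
  1 < p -> 0 < sigma -> measurable_fun [set: L] (u : L -> R) -> enorm y <= 3 / 2 ->
  0 < rho ->
  (\int[mu]_(z in [set z : L | (2 <= enorm z)%R])
     (`|u z| `^ (p - 1) / enorm z `^ (n%:R + sigma))%:E <= T%:E)%E ->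
  (\int[mu]_(z in [set z : L | (rho <= enorm z)%R])
     (exterior u (y + z) `^ (p - 1) / enorm z `^ (n%:R + sigma))%:E <=
   (4 `^ (n%:R + sigma) * T)%:E)%E.
Proof.
move=> p1 s0 mu' y32 r0 hT.
have p0 : p - 1 != 0 by rewrite gt_eqF// subr_gt0.
set a := n%:R + sigma; have a0 : 0 <= a by rewrite addr_ge0 ?ler0n// ltW.
pose h (z : L) := exterior u z `^ (p - 1) / enorm z `^ a.
have mh : measurable_fun [set: L] h.
  by apply: measurable_kernel; exact: measurableT_comp (measurable_powR _) (measurable_exterior mu').
have h0 z : 0 <= h z by rewrite divr_ge0 ?powR_ge0.
have mhy := measurable_translate y mh.
have hy0 z : 0 <= h (y + z) by exact: h0.
have hE : (\int[mu]_z (h z)%:E = \int[mu]_(z in [set z : L | (2 <= enorm z)%R])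
     (`|u z| `^ (p - 1) / enorm z `^ a)%:E)%E.
  rewrite [RHS]integral_mkcond; apply: eq_integral => z _.
  rewrite patchE /h /exterior; case: ifPn => [z2|z2].
    by rewrite mem_set.
  by rewrite memNset ?powR0// ?mul0r//; exact/negP.
rewrite -hE in hT.
have mD : measurable ([set z : L | rho <= enorm z]) := measurable_enorm_ge rho.
have mG : measurable_fun [set: L]
    (fun z : L => exterior u (y + z) `^ (p - 1) / enorm z `^ a).
  apply: measurable_kernel; apply: (measurableT_comp (measurable_powR _)).
  exact: (measurable_translate y (measurable_exterior mu')).
apply: (@le_trans _ _ (\int[mu]_(z in [set z : L | (rho <= enorm z)%R])
    (4 `^ a * h (y + z))%:E)%E).
  apply: (ge0_le_integral mu mD).
  - by move=> z _; rewrite lee_fin divr_ge0 ?powR_ge0.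
  - by apply/measurable_EFinP; exact: measurable_funTS mG.
  - by apply/measurable_EFinP; exact: measurable_funTS (measurable_cstM _ mhy).
  move=> z /= rz; rewrite lee_fin /h /exterior mulrCA.
  have [y2|y2] := leP 2 (enorm (y + z)); last first.
    by rewrite powR0; [rewrite !mul0r|exact: p0].
  have yz : enorm (y + z) / 4 <= enorm z by have := ler_enormD y z; lra.
  rewrite (ler_wpM2l (powR_ge0 _ _))//; apply: (translated_kernel_le a0 _ yz).
  exact: lt_le_trans y2.
rewrite (ge0_integral_cstM mD mhy hy0 (powR_ge0 _ _)) EFinM.
apply: lee_wpmul2l; first by rewrite lee_fin powR_ge0.
apply: le_trans hT; have e1 : (1 : R) ^+ 2 = 1 by rewrite expr1n.
rewrite [X in (_ <= X)%E](ge0_integral_sign_shift y e1 (@measurableT _ L)); first last.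
- by move=> x _; rewrite lee_fin.
- by apply/measurable_EFinP; exact: mh.
rewrite preimage_setT.
under [X in (_ <= X)%E]eq_integral do rewrite /sign_shift scale1r.
apply: (ge0_subset_integral mu mD (@measurableT _ L)).
- by apply/measurable_EFinP; exact: mhy.
- by move=> x _; rewrite lee_fin.
- by [].
Qed.

Variables (s p m theta theta1 D : R) (H : 'rV[R]_n -> 'rV[R]_n -> R) (u : 'rV[R]_n -> R).
Hypotheses (s01 : 0 < s < 1) (p_gt1 : 1 < p).
Hypothesis H_ge : forall x xi, theta * enorm xi `^ m - theta1 <= H x xi.
Hypothesis u_sub : viscosity_subsolution s p H (fun=> D) (eball 0 2) u.
Hypothesis u_meas : measurable_fun [set: L] (u : L -> R).
Variables (a T : R).
Hypothesis u_bnd : forall x, eball 0 2 x -> `|u x| <= a.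
Hypothesis u_tail : (\int[mu]_(z in [set z : L | (2 <= enorm z)%R])
     (`|u z| `^ (p - 1) / enorm z `^ (n%:R + s * p))%:E <= T%:E)%E.

Definition touching_bound (gamma c M rho d S : R) : R :=
  (c * gamma * d `^ (gamma - 2) / 2) `^ (p - 1) *
    (near_const n p (s * p) * d `^ (2 * (p - 1) - s * p))
  + c `^ (p - 1) * S
  + 2 `^ (p - 1) * (M `^ (p - 1) *
      (shell_const (n := n) (- (s * p)) / (1 - 2 `^ (- (s * p))) * rho `^ (- (s * p)))
      + 4 `^ (n%:R + s * p) * T).

(* The test function is a paraboloid tangent to [c * |x - w| ^ gamma] along the
   sphere through [y]. It lies above by Bernoulli's inequality, and its gradient at
   [y] does not vanish, so that the degenerate case of the definition of viscosity
   subsolutions never occurs. *)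
Lemma touching_ineq (w y : 'rV[R]_n) (gamma c M rho S : R) :
  enorm w <= 1 -> 0 < gamma <= 1 -> 0 < c -> 2 * a <= M -> rho <= 1 / 2 ->
  0 < enorm (y - w) -> enorm (y - w) < rho ->
  (forall x, eball 0 2 x ->
     u x - c * enorm (x - w) `^ gamma <= u y - c * enorm (y - w) `^ gamma) ->
  (\int[mu]_(z in [set z : L | (enorm (y - w) <= enorm z < rho)%R])
      (enorm z `^ (gamma * (p - 1) - s * p - n%:R))%:E <= S%:E)%E ->
  theta * (c * gamma * enorm (y - w) `^ (gamma - 1)) `^ m <=
    D + theta1 + touching_bound gamma c M rho (enorm (y - w)) S.
Proof.
move=> w1 g01 c0 aM r2 d0 dr touch hS.
have /andP[s0 s1] := s01; have /andP[g0 g1] := g01.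
have p0 : 0 < p by exact: lt_trans p_gt1.
have sp0 : 0 < s * p by rewrite mulr_gt0.
have spp : s * p < p by rewrite gtr_pMl.
pose v := y - w; rewrite -/v in d0 dr touch hS *; set d := enorm v in d0 dr touch hS *.
pose k := c * gamma * d `^ (gamma - 2) / 2.
have k0 : 0 <= k by rewrite !mulr_ge0 ?powR_ge0// ltW.
pose phi := paraboloid (u y - k * d ^+ 2) k w.
have y32 : enorm y <= 3 / 2.
  by have := ler_enormD v w; rewrite /v subrK -/v -/d; lra.
have vz z : y + z - w = v + z by rewrite /v addrAC.
have in2 z : enorm z < 1 / 2 -> eball 0 2 (y + z).
  by move=> z2; rewrite /eball /= subr0; have := ler_enormD y z; lra.
have bE z : eball y d (y + z) <-> enorm z < d.
  by rewrite /eball /= addrC addKr.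
have sub : eball y d `<=` eball 0 2.
  move=> x xd; have -> : x = y + (x - y) by rewrite addrC subrK.
  by apply: in2; move: xd; rewrite /eball /=; lra.
have phiy : phi y = u y by rewrite /phi /paraboloid -/v -/d subrK.
have uphi x : eball y d x -> u x <= phi x.
  move=> xd; have h2 := touch x (sub _ xd).
  have h1 := powR_le_paraboloid g01 d0 (enorm_ge0 (x - w)).
  rewrite -(ler_pM2l c0) in h1; rewrite /phi /paraboloid /k.
  exact: concave_touching_step h1 h2.
have gradE : grad phi y = (2 * k) *: v by rewrite /phi grad_paraboloid.
have kd : 2 * k * d = c * gamma * d `^ (gamma - 1).
  rewrite /k (_ : gamma - 1 = (gamma - 2) + 1); last by ring.
  by rewrite [X in _ = _ * X]powR_add// (powRr1 (ltW d0)); field.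
have kd0 : 0 < 2 * k * d by rewrite kd !mulr_gt0 ?powR_gt0.
have k20 : 0 <= 2 * k by rewrite mulr_ge0.
have gradn : enorm (grad phi y) = 2 * k * d by rewrite gradE enormZ (ger0_norm k20).
have nz : grad phi y != 0.
  by rewrite -enorm_gt0 gradn.
have C2phi : C2 (eball y d) phi by exact: C2_paraboloid.
case: u_sub => _ /(_ y d phi d0 sub C2phi phiy uphi (or_introl (or_intror nz)))
  [l plap l_le] _.
set phir := test_replace _ _ _ in plap l_le.
pose delta (z : L) := if enorm z < d then - (k * (2 * dotp v z + enorm z ^+ 2))
  else u y - u (y + z).
have deltaE z : phir y - phir (y + z) = delta z.
  rewrite /phir /test_replace mem_set; last by rewrite /eball /= subrr enorm0.
  rewrite phiy /delta; case: ifPn => [|zd].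
    rewrite inE bE => zd; rewrite zd /phi /paraboloid vz sqr_enormD -/d; ring.
  by case: ifPn zd => // zd; rewrite mem_set//; exact/bE.
have md : measurable_fun [set: L] delta.
  apply: measurable_fun_ifT.
  - exact: measurable_fun_ltr measurable_enorm (measurable_cst _).
  - apply: measurableT_comp (@oppr_measurable R _) _; apply: measurable_cstM.
    apply: measurable_funD; first exact: measurable_cstM (measurable_dotp v).
    exact: measurable_funX measurable_enorm.
  - exact: measurable_funB (measurable_cst _) (measurable_translate y u_meas).
pose g (z : L) := exterior u (y + z).
have mg : measurable_fun [set: L] g := measurable_translate y (measurable_exterior u_meas).
have a0 : 0 <= a by apply: le_trans (u_bnd (sub _ _)); last by apply/(bE 0); rewrite ?addr0 ?enorm0.
have uya : `|u y| <= a.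
  by apply: u_bnd; rewrite -[y]addr0; apply: in2; rewrite enorm0; lra.
have trunc eps : 0 < eps -> eps < d ->
    (- (touching_bound gamma c M rho d S)%:E <= truncated_frac_plap s p phir y eps)%E.
  move=> e0 ed; rewrite /truncated_frac_plap.
  under eq_integral do rewrite deltaE.
  apply: (@truncated_ge R n p (s * p) p_gt1 sp0 spp v delta g eps k rho c gamma M S
    (4 `^ (n%:R + s * p) * T) md mg) => //.
  - by move=> z; exact: exterior_ge0.
  - exact: ltW.
  - by apply: le_trans aM; lra.
  - by move=> z zd; rewrite /delta zd.
  - move=> z /andP[dz zr]; rewrite /delta ltNge dz /=.
    have z2 : enorm z < 1 / 2 by exact: lt_le_trans r2.
    have := touch _ (in2 z z2); rewrite vz => h.
    have h1 : enorm (v + z) `^ gamma <= d `^ gamma + enorm z `^ gamma.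
      apply: le_trans (powR_subadd g01 (enorm_ge0 _) (enorm_ge0 _)).
      by apply: powR_le => //; [exact: ltW|exact: enorm_ge0|exact: ler_enormD].
    exact: hoelder_touching_step c0 h1 h.
  - move=> z rz; have dz : d <= enorm z by apply: ltW; exact: lt_le_trans rz.
    rewrite /delta ltNge dz /= /g /exterior.
    move: uya; rewrite ler_norml => /andP[uy1 uy2].
    case: ifPn => [_|]; first by have := ler_norm (u (y + z)); lra.
    rewrite -ltNge => yz2; have : `|u (y + z)| <= a by apply: u_bnd; rewrite /eball /= subr0.
    by rewrite ler_norml => /andP[h1 h2]; lra.
  - exact: (integral_exterior_translate p_gt1 sp0 u_meas y32 (lt_trans d0 dr) u_tail).
have l_ge : (- (touching_bound gamma c M rho d S)%:E <= l)%E.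
  apply: (cvge_ge _ plap).
  near=> eps; apply: trunc; near: eps; [exact: nbhs_right_gt|exact: nbhs_right_lt].
have Hy := H_ge y (grad phir y).
have grE : enorm (grad phir y) = 2 * k * d.
  by rewrite /phir grad_test_replace// gradn.
rewrite grE kd in Hy.
have : (- (touching_bound gamma c M rho d S)%:E + (H y (grad phir y))%:E <= D%:E)%E.
  by apply: le_trans l_le; exact: leeD2r.
rewrite -EFinN -EFinD lee_fin; lra.
Unshelve. all: by end_near. Qed.

End touching_point.

Section upper_semicontinuous_max.
Context {R : realType} {n : nat}.
Implicit Types (x y w : 'rV[R]_n) (K : set 'rV[R]_n).

Lemma usc_attains_max K (f : 'rV[R]_n -> R) : compact K -> K !=set0 ->
  (forall x, K x -> forall b, f x < b -> \forall y \near x, K y -> f y < b) ->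
  exists2 y, K y & forall z, K z -> f z <= f y.
Proof.
move=> cK [x0 Kx0] usc.
pose B z := [set x | K x /\ f z <= f x].
pose F := filter_from K B.
have FF : ProperFilter F.
  apply: filter_from_proper; last by move=> z Kz; exists z.
  apply: filter_from_filter; first by exists x0.
  move=> z1 z2 K1 K2; have [h|h] := leP (f z1) (f z2).
    by exists z2 => // x [Kx hx]; do 2 split => //; exact: le_trans hx.
  by exists z1 => // x [Kx hx]; do 2 split => //; exact: le_trans (ltW h) hx.
have FK : F K by exists x0 => // x [].
have [y [Ky cly]] := cK F FF FK.
exists y => // z Kz; rewrite leNgt; apply/negP => yz.
have FB : F (B z) by exists z.
by have [x [[Kx zx] /(_ Kx)]] := cly _ _ FB (usc y Ky _ yz); rewrite ltNge zx.
Qed.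

Lemma mx_norm_le_enorm x : `|x| <= enorm x.
Proof.
rewrite /Num.Def.normr/=; have [->|x0] := eqVneq (mx_norm x) 0; first exact: enorm_ge0.
have [[i j] /= ->] := mx_norm_neq0 x0.
by rewrite (ord1 i) coord_le_enorm.
Qed.

Lemma continuous_enorm_sub w : continuous (fun x => enorm (x - w)).
Proof.
move=> y; apply: (@continuous_comp _ _ _ (fun x => x - w) enorm).
  apply: (@continuousD _ _ _ id (cst (- w))); first exact: cvg_id.
  exact: cst_continuous.
exact: continuous_enorm.
Qed.

Lemma closed_ecball w (r : R) : closed (ecball w r).
Proof.
rewrite (_ : ecball w r = (fun x => enorm (x - w)) @^-1` [set t | t <= r]).
  by apply: closed_comp; [move=> x _; exact: continuous_enorm_sub|exact: closed_le].
by [].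
Qed.

Lemma compact_ecball w (r : R) : compact (ecball w r).
Proof.
apply: bounded_closed_compact; last exact: closed_ecball.
exists (r + enorm w); split; first exact: num_real.
move=> M hM x xw; apply: le_trans (mx_norm_le_enorm x) _; apply: le_trans (ltW hM).
have := ler_enormD (x - w) w; rewrite subrK => h; apply: le_trans h _.
by rewrite lerD2r.
Qed.

Lemma closure_eball_sub w (r : R) : closure (eball w r) `<=` ecball w r.
Proof.
rewrite [X in _ `<=` X]((closure_id _).1 (@closed_ecball w r)).
by apply: closureS => x /ltW.
Qed.

Lemma compact_closure_eball w (r : R) : compact (closure (eball w r)).
Proof.
exact: (subclosed_compact (@closed_closure _ _) (@compact_ecball w r)
  (@closure_eball_sub w r)).
Qed.

Lemma near_sub_eball x (r : R) : enorm x < r -> \forall y \near x, eball 0 r y.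
Proof.
move=> xr; have := cvgr_lt _ (@continuous_enorm R n x) => /(_ (nbhs_filter x) r xr).
by apply: filterS => y yr; rewrite /eball /= subr0.
Qed.

End upper_semicontinuous_max.

Lemma usc_difference_step (R : realFieldType) (U U' X X' b e : R) :
  e = (b - (U - X)) / 2 -> U' < U + e -> X - e < X' -> U' - X' < b.
Proof. by move=> -> h1 h2; lra. Qed.

Lemma far_difference_step (R : realFieldType) (U W X a M : R) :
  U <= a -> - a <= W -> 2 * a < M -> M <= X -> U - X < W.
Proof. by move=> *; lra. Qed.

Section one_sided_bound.
Context {R : realType} {n : nat}.

Lemma one_sided_hoelder (u : 'rV[R]_n -> R) (w : 'rV[R]_n) (a c gamma M rho : R) :
  upper_semicontinuous_in (closure (eball 0 2)) u ->
  (forall x, eball 0 2 x -> `|u x| <= a) ->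
  enorm w <= 1 -> 0 < gamma <= 1 -> 0 < rho -> rho <= 1 / 2 -> 0 < c ->
  2 * a < M -> c * rho `^ gamma = M ->
  (forall y, 0 < enorm (y - w) -> enorm (y - w) < rho ->
     ~ (forall x, eball 0 2 x ->
       u x - c * enorm (x - w) `^ gamma <= u y - c * enorm (y - w) `^ gamma)) ->
  forall x, eball 0 2 x -> u x - u w <= c * enorm (x - w) `^ gamma.
Proof.
move=> usc ua w1 g01 r0 r2 c0 aM cM notouch x x2.
have /andP[g0 g1] := g01.
rewrite leNgt; apply/negP => hx.
pose f z := u z - c * enorm (z - w) `^ gamma.
have in2 z : enorm (z - w) <= rho -> eball 0 2 z.
  move=> zr; rewrite /eball /= subr0.
  by have := ler_enormD (z - w) w; rewrite subrK; lra.
have w2 : eball 0 2 w by apply: in2; rewrite subrr enorm0 ltW.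
have fw : f w = u w by rewrite /f subrr enorm0 powR0 ?gt_eqF// mulr0 subr0.
have fx : u w < f x by rewrite /f; lra.
have ub z : eball 0 2 z -> - a <= u z /\ u z <= a.
  by move=> /ua; rewrite ler_norml => /andP[].
have far z : eball 0 2 z -> rho <= enorm (z - w) -> f z < u w.
  move=> z2 rz; have [_ h2] := ub z z2; have [h3 _] := ub w w2.
  have h : M <= c * enorm (z - w) `^ gamma.
    by rewrite -cM ler_pM2l//; apply: powR_le => //; exact: ltW.
  exact: far_difference_step h2 h3 aM h.
have xr : enorm (x - w) < rho.
  by rewrite ltNge; apply/negP => /(far x x2) /(lt_trans fx); rewrite ltxx.
have [y yr fy] : exists2 y, ecball w rho y & forall z, ecball w rho z -> f z <= f y.
  apply: usc_attains_max; first exact: compact_ecball.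
    by exists w; rewrite /ecball /= subrr enorm0 ltW.
  move=> z zr b fzb; have z2 := in2 z zr.
  pose e := (b - f z) / 2; have e0 : 0 < e by rewrite /e divr_gt0// subr_gt0.
  have h1 : \forall t \near z, u t < u z + e.
    have := usc z (subset_closure z2) (u z + e); rewrite ltrDl => /(_ e0).
    rewrite near_withinE => h; near=> t.
    have t2 : eball 0 2 t.
      by near: t; apply: near_sub_eball; move: z2; rewrite /eball /= subr0.
    by apply: (near h t) => //; exact: subset_closure.
  have h2 : \forall t \near z, c * enorm (z - w) `^ gamma - e < c * enorm (t - w) `^ gamma.
    have ec : 0 < e / c by rewrite divr_gt0.
    have q0 : 0 < (e / c) `^ gamma^-1 by rewrite powR_gt0.
    apply: filterS (near_eball z q0) => t; rewrite /eball /= => tz.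
    have := powR_lt g0 (enorm_ge0 (t - z)) tz.
    rewrite -powRrM mulVf ?gt_eqF// powRr1 ?(ltW ec)// ltr_pdivlMr// mulrC => h.
    have h' : enorm (z - w) `^ gamma <= enorm (t - w) `^ gamma + enorm (t - z) `^ gamma.
      apply: le_trans (powR_subadd g01 (enorm_ge0 _) (enorm_ge0 _)).
      apply: powR_le => //; [exact: ltW|exact: enorm_ge0|].
      rewrite (enorm_subC t z) -[X in enorm X](subrKA t) addrC.
      exact: ler_enormD.
    by rewrite -(ler_pM2l c0) mulrDr in h'; rewrite ltrBlDr; apply: le_lt_trans h' _; rewrite ltrD2l.
  near=> t => _; have t1 : u t < u z + e by near: t.
  have t2 : c * enorm (z - w) `^ gamma - e < c * enorm (t - w) `^ gamma by near: t.
  exact: usc_difference_step erefl t1 t2.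
have fxy : f x <= f y by apply: fy; exact: ltW.
have y2 := in2 y yr.
have uwy := lt_le_trans fx fxy.
have yr' : enorm (y - w) < rho.
  by rewrite ltNge; apply/negP => /(far y y2) /(lt_trans uwy); rewrite ltxx.
have y0 : 0 < enorm (y - w).
  rewrite enorm_gt0 subr_eq0; by apply/eqP => yw; move: uwy; rewrite yw fw ltxx.
apply: (notouch y y0 yr') => z z2; rewrite -/(f z) -/(f y).
have [zr|rz] := leP (enorm (z - w)) rho; first exact: fy.
exact: ltW (lt_trans (far z z2 (ltW rz)) uwy).
Unshelve. all: by end_near. Qed.

End one_sided_bound.

Section finiteness.
Context {R : realType} {n : nat}.
Local Notation L := (lebesgue_type R n).
Local Notation mu := (lebesgue_rV R n).
Implicit Types (x : 'rV[R]_n) (u : 'rV[R]_n -> R).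

Lemma lebesgue_nbhs_gt0 x (A : set 'rV[R]_n) : nbhs x A ->
  exists B : set L, [/\ measurable B, B `<=` A & (0 < mu B)%E].
Proof.
move=> /nbhs_ballP[e /= e0 eA].
have e1 : (1 : R) ^+ 2 = 1 by rewrite expr1n.
have e2 : 0 <= e / 2 by rewrite divr_ge0// ltW.
exists (sign_shift (- x) 1 @^-1` cube (e / 2)); split.
- rewrite -[X in measurable X]setTI; apply: measurable_sign_shift => //.
  by apply: measurable_borel_lebesgue; exact: measurable_box.
- move=> y yc; apply: eA; split => // i j; rewrite (ord1 i).
  have := yc j; rewrite /= /sign_shift scale1r !mxE in_itv/= -ler_norml.
  rewrite /ball /= distrC addrC => h; apply: le_lt_trans h _; lra.
rewrite lebesgue_rV_sign_shift// lebesgue_rV_cube// lte_fin.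
by rewrite exprn_gt0// mulr_gt0// divr_gt0.
Qed.

Lemma usc_bounded_above u : upper_semicontinuous_in (closure (eball 0 2)) u ->
  exists b, forall x, eball 0 2 x -> u x <= b.
Proof.
move=> usc; have [||y _ hy] := @usc_attains_max R n (closure (eball 0 2)) u
    (@compact_closure_eball _ _ _ _).
- by exists 0; apply: subset_closure; rewrite /eball /= subrr enorm0.
- by move=> x Kx b ub; have := usc x Kx b ub; rewrite near_withinE.
by exists (u y) => x x2; apply: hy; exact: subset_closure.
Qed.

(* A point where [u < b] has, by upper semicontinuity, a neighbourhood where
   [u < b], and this has positive measure: the essential bound holds everywhere. *)
Lemma usc_bounded_below u : upper_semicontinuous_in (closure (eball 0 2)) u ->
  (u \_ (ecball 0 2)) \in Lfun mu +oo%E ->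
  exists b, forall x, eball 0 2 x -> b <= u x.
Proof.
move=> usc /sub_Lfun_finLfun; rewrite inE /= /finite_norm unlock.
have muT : (0 < mu [set: L])%E.
  have [B [mB _ B0]] := @lebesgue_nbhs_gt0 0 setT filterT.
  by apply: (lt_le_trans B0); apply: le_measure; rewrite ?inE.
rewrite muT; set N := ess_sup _ _ => Noo.
have [r Nr] : exists r : R, (N <= r%:E)%E.
  by case: N Noo => [r _|//|_]; [exists r|exists 0; exact: leNye].
exists (- (r + 1)) => x x2; rewrite leNgt; apply/negP => ux.
have [Z [mZ Z0 hZ]] : mu.-negligible
    (~` [set z : L | (abse \o (EFin \o (u \_ (ecball 0 2)))) z <= N]%E) := ess_sup_ge mu _.
have xA : nbhs x [set z | eball 0 2 z /\ u z < - (r + 1)].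
  have h1 := usc x (subset_closure x2) _ ux; rewrite near_withinE in h1.
  have h2 : \forall z \near x, eball 0 2 z.
    by apply: near_sub_eball; move: x2; rewrite /eball /= subr0.
  by apply: filterS2 h1 h2 => z h z2; split => //; exact: h (subset_closure z2).
have [B [mB BA B0]] := lebesgue_nbhs_gt0 xA.
suff BZ : B `<=` Z.
  have : (mu B <= mu Z)%E by apply: le_measure; rewrite ?inE.
  by rewrite Z0 leNgt B0.
move=> z /BA[z2 uz]; apply: hZ => /= zN.
have := le_trans zN Nr; rewrite patchE mem_set; last exact: ltW.
rewrite lee_fin => h; have := le_trans (ler_norm (- u z)) (_ : `|- u z| <= r).
rewrite normrN => /(_ h); lra.
Qed.

Lemma tail_integral_fin (s p : R) u : 0 < s * p -> tail_space s p u ->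
  (\int[mu]_(z in [set z : L | (2 <= enorm z)%R])
     (`|u z| `^ (p - 1) / enorm z `^ (n%:R + s * p))%:E < +oo)%E.
Proof.
move=> sp0 [mu' _ hT]; set a := n%:R + s * p in hT *.
have a0 : 0 <= a by rewrite addr_ge0 ?ler0n// ltW.
have mD : measurable ([set z : L | 2 <= enorm z]) := measurable_enorm_ge 2.
have mup : measurable_fun [set: L] (fun z : L => `|u z| `^ (p - 1)).
  apply: (measurableT_comp (measurable_powR _)).
  exact: measurableT_comp (@normr_measurable R _) mu'.
have mf : measurable_fun [set: L] (fun z : L => `|u z| `^ (p - 1) / enorm z `^ a).
  exact: measurable_kernel.
pose g (z : L) := `|u z| `^ (p - 1) / (1 + enorm z) `^ a.
have mg : measurable_fun [set: L] g.
  have mk : measurable_fun [set: L] (fun z : L => ((1 + enorm z) `^ a)^-1).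
    under eq_fun do rewrite -powRN.
    apply: (measurableT_comp (measurable_powR _)).
    exact: measurable_funD (measurable_cst _) measurable_enorm.
  exact: measurable_funM mup mk.
have g0 z : 0 <= g z by rewrite divr_ge0 ?powR_ge0.
apply: (@le_lt_trans _ _ (\int[mu]_(z in [set z : L | (2 <= enorm z)%R]) (2 `^ a * g z)%:E)%E).
  apply: (ge0_le_integral mu mD).
  - by move=> z _; rewrite lee_fin divr_ge0 ?powR_ge0.
  - by apply/measurable_EFinP; exact: measurable_funTS mf.
  - by apply/measurable_EFinP; exact: measurable_funTS (measurable_cstM _ mg).
  move=> z /= z2; rewrite lee_fin /g mulrCA ler_wpM2l ?powR_ge0//.
  have z0 : 0 < enorm z by lra.
  rewrite ler_pdivlMr ?powR_gt0//; last by lra.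
  rewrite mulrC ler_pdivrMr ?powR_gt0// -powRM ?enorm_ge0//.
  by apply: powR_le => //; lra.
rewrite (ge0_integral_cstM mD mg g0 (powR_ge0 _ _)).
apply: lte_mul_pinfty; [by rewrite lee_fin powR_ge0|by []|].
apply: le_lt_trans hT; apply: (ge0_subset_integral mu mD (@measurableT _ L)).
- by apply/measurable_EFinP; exact: mg.
- by move=> x _; rewrite lee_fin.
- by [].
Qed.

Lemma sup_tail_bounds (s p : R) u (A : \bar R) : 0 < s * p -> 1 < p ->
  upper_semicontinuous_in (closure (eball 0 2)) u ->
  (u \_ (ecball 0 2)) \in Lfun mu +oo%E -> tail_space s p u ->
  A = (ereal_sup [set `|u x|%:E | x in eball 0 2] + Tail s p u 0 2)%E ->
  exists a : R, [/\ A = a%:E, 0 <= a, forall x, eball 0 2 x -> `|u x| <= a &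
    (\int[mu]_(z in [set z : L | (2 <= enorm z)%R])
     (`|u z| `^ (p - 1) / enorm z `^ (n%:R + s * p))%:E <= (a `^ (p - 1))%:E)%E].
Proof.
move=> sp0 p1 usc uL ts AE.
have [b1 hb1] := usc_bounded_above usc; have [b2 hb2] := usc_bounded_below usc uL.
have := tail_integral_fin sp0 ts; set I := (X in (X < +oo)%E) => Ioo.
have I0 : (0 <= I)%E by apply: integral_ge0 => z _; rewrite lee_fin divr_ge0 ?powR_ge0.
have [i IE] : exists i, I = i%:E by exists (fine I); rewrite fineK// ge0_fin_numE.
have i0 : 0 <= i by rewrite -lee_fin -IE.
pose t := (2 `^ (s * p) * i) `^ (p - 1)^-1.
have TE : Tail s p u 0 2 = t%:E.
  rewrite /Tail (_ : \int[mu]_(z in _) _ = I)%E; last first.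
    by rewrite /I; under eq_set do rewrite subr0; under eq_integral do rewrite subr0.
  by rewrite IE -EFinM poweR_EFin.
set S := ereal_sup _ in AE.
have Sle : (S <= (`|b1| + `|b2|)%:E)%E.
  apply: ge_ereal_sup => _ [x x2 <-]; rewrite lee_fin.
  have h1 := hb1 x x2; have h2 := hb2 x x2.
  have h3 := ler_norm b1; have h4 := ler_norm (- b2); rewrite normrN in h4.
  have h5 := normr_ge0 b1; have h6 := normr_ge0 b2.
  by rewrite ler_norml; apply/andP; split; lra.
have SP x : eball 0 2 x -> (`|u x|%:E <= S)%E.
  by move=> x2; apply: ereal_sup_ubound; exists x.
have S0 : (0 <= S)%E.
  apply: le_trans (SP 0 _); first by rewrite lee_fin.
  by rewrite /eball /= subrr enorm0.
have Sfin : S \is a fin_num by rewrite ge0_fin_numE//; exact: le_lt_trans Sle (ltry _).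
have [r SE] : exists r, S = r%:E by exists (fine S); rewrite fineK.
have r0 : 0 <= r by rewrite -lee_fin -SE.
have t0 : 0 <= t by exact: powR_ge0.
exists (r + t); split.
- by rewrite AE SE TE.
- exact: addr_ge0.
- move=> x /SP; rewrite SE lee_fin => h; lra.
suff : (I <= ((r + t) `^ (p - 1))%:E)%E by [].
rewrite IE lee_fin.
have p0 : 0 < p - 1 by rewrite subr_gt0.
have h : 2 `^ (s * p) * i = t `^ (p - 1).
  by rewrite /t -powRrM mulVf ?gt_eqF// powRr1// mulr_ge0 ?powR_ge0.
apply: (@le_trans _ _ (2 `^ (s * p) * i)).
  by rewrite ler_peMl// powR_ge1 ?ler1n// ltW.
by rewrite h; apply: powR_le; [exact: ltW|exact: t0|lra].
Qed.

End finiteness.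

(** * Choice of the scale *)

Lemma absorb_positive (R : realFieldType) (K0 N V k1 k2 B Y Z W : R) :
  N <= k1 -> K0 + V <= B - (k1 + k2) -> B < Y -> Y <= Z -> Z <= W ->
  K0 + (N + k2 + V) < W.
Proof. by move=> *; lra. Qed.

Lemma absorb_negative (R : realFieldType) (K0 N V k1 k2 B Y Z : R) :
  N <= Z -> K0 + V <= B - (k1 + k2) -> 0 <= k1 -> 0 <= k2 -> B < Y -> Y <= Z ->
  K0 + (N + V) < Z + Z.
Proof. by move=> *; lra. Qed.

Section scale_choice.
Context {R : realType}.

Lemma powR_small (B e al : R) : 0 <= B -> 0 < e -> 0 < al ->
  exists2 r0 : R, 0 < r0 & forall r, 0 < r -> r < r0 -> B * r `^ al < e.
Proof.
move=> B0 e0 al0; have q0 : 0 < e / (B + 1) by rewrite divr_gt0//; lra.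
exists ((e / (B + 1)) `^ al^-1); first exact: powR_gt0.
move=> r r0 rr; have := powR_lt al0 (ltW r0) rr.
rewrite -powRrM mulVf ?gt_eqF// powRr1 ?(ltW q0)// ltr_pdivlMr; last by lra.
have := powR_gt0 al r0; set q := r `^ al => q1; nra.
Qed.

Lemma main_term_ge (m gamma M d rho : R) : 0 < gamma <= 1 -> 0 < m -> 0 < M -> 0 < d -> d < rho ->
  M `^ m * rho `^ (- m) <= (M * rho `^ (- gamma)) `^ m * d `^ ((gamma - 1) * m).
Proof.
move=> /andP[g0 g1] m0 M0 d0 dr; have r0 := lt_trans d0 dr.
rewrite powRM ?powR_ge0 ?(ltW M0)// -powRrM -mulrA ler_pM2l ?powR_gt0//.
have -> : rho `^ (- m) = rho `^ (- gamma * m) * rho `^ ((gamma - 1) * m).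
  by rewrite -powR_add//; congr powR; ring.
rewrite ler_pM2l ?powR_gt0//.
have -> : (gamma - 1) * m = - ((1 - gamma) * m) by ring.
rewrite !powRN lef_pV2 ?posrE ?powR_gt0//; apply: powR_le; [|exact: ltW|exact: ltW].
by rewrite mulr_ge0 ?subr_ge0// ltW.
Qed.

(* Bounds the integral of [|z| ^ (kappa - n)] over [d <= |z| < rho] up to a factor:
   it is governed by the outer radius if [0 < kappa], by the inner one if [kappa < 0]. *)
Definition annulus_bound (K kappa rho d : R) : R :=
  K * (if 0 < kappa then rho else d) `^ kappa.

Lemma near_term_le (p sigma gamma c d K : R) : 1 < p -> 0 < gamma <= 1 -> 0 < c -> 0 < d ->
  0 <= K ->
  (c * gamma * d `^ (gamma - 2) / 2) `^ (p - 1) * (K * d `^ (2 * (p - 1) - sigma)) <=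
  c `^ (p - 1) * (K * d `^ (gamma * (p - 1) - sigma)).
Proof.
move=> p1 /andP[g0 g1] c0 d0 K0; have p0 : 0 <= p - 1 by lra.
have -> : d `^ (gamma * (p - 1) - sigma) =
    (d `^ (gamma - 2)) `^ (p - 1) * d `^ (2 * (p - 1) - sigma).
  by rewrite -powRrM -powR_add//; congr powR; ring.
have h : (c * gamma * d `^ (gamma - 2) / 2) `^ (p - 1) <= c `^ (p - 1) * (d `^ (gamma - 2)) `^ (p - 1).
  rewrite -powRM ?powR_ge0 ?(ltW c0)//; apply: powR_le => //.
    by rewrite !mulr_ge0 ?powR_ge0// ltW.
  have : 0 <= c * d `^ (gamma - 2) by rewrite mulr_ge0 ?powR_ge0// ltW.
  have -> : c * gamma * d `^ (gamma - 2) / 2 = c * d `^ (gamma - 2) * (gamma / 2) by ring.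
  by move=> q0; rewrite ler_piMr//; lra.
have K1 : 0 <= K * d `^ (2 * (p - 1) - sigma) by rewrite mulr_ge0 ?powR_ge0.
by apply: le_trans (ler_wpM2r K1 h) _; rewrite le_eqVlt; apply/orP; left; apply/eqP; ring.
Qed.

(* For [kappa > 0] everything is at most a multiple of [rho ^ (- sigma)], which
   [rho ^ (- m)] beats; for [kappa < 0] the term [c ^ (p - 1) * d ^ kappa] is
   absorbed by half of the coercive term, since [c] is large and [p - 1 < m]. *)
Lemma exists_scale (p sigma m theta gamma M K0 Kn Ks Kf T : R) :
  1 < p -> 0 < sigma -> sigma < m -> 0 < theta -> 0 < gamma <= 1 -> 0 < M ->
  0 <= K0 -> 0 <= Kn -> 0 <= Ks -> 0 <= Kf -> 0 <= T ->
  let kappa := gamma * (p - 1) - sigma in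
  0 < kappa \/ [/\ kappa < 0, (gamma - 1) * m <= kappa & p - 1 < m] ->
  exists rho : R, [/\ 0 < rho, rho <= 1 / 2 & forall d : R, 0 < d -> d < rho ->
    let c := M * rho `^ (- gamma) in
    K0 + ((c * gamma * d `^ (gamma - 2) / 2) `^ (p - 1) *
            (Kn * d `^ (2 * (p - 1) - sigma))
          + c `^ (p - 1) * annulus_bound Ks kappa rho d
          + 2 `^ (p - 1) * (M `^ (p - 1) * (Kf * rho `^ (- sigma)) + T))
    < theta * (c * gamma * d `^ (gamma - 1)) `^ m].
Proof.
move=> p1 s0 sm th0 g01 M0 K00 Kn0 Ks0 Kf0 T0 kappa hk.
have /andP[g0 g1] := g01; have m0 : 0 < m := lt_trans s0 sm.
have p0 : 0 <= p - 1 by lra.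
pose b := theta * gamma `^ m; have b0 : 0 < b by rewrite mulr_gt0 ?powR_gt0.
pose Mp := M `^ (p - 1); have Mp0 : 0 <= Mp := powR_ge0 _ _.
pose B := K0 + (Kn + Ks) * Mp + 2 `^ (p - 1) * (Mp * Kf + T).
have w0 : 0 <= (2 : R) `^ (p - 1) := powR_ge0 _ _.
have B0 : 0 <= B by rewrite /B !addr_ge0// mulr_ge0// addr_ge0// mulr_ge0.
have e0 : 0 < b / 2 * M `^ m by rewrite mulr_gt0 ?powR_gt0// divr_gt0.
have ms0 : 0 < m - sigma by rewrite subr_gt0.
have [r1 r10 hr1] := powR_small B0 e0 ms0.
have [r2 r20 hr2] : exists2 r2 : R, 0 < r2 & (kappa < 0 -> forall r, 0 < r -> r < r2 ->
    (Kn + Ks) * (M * r `^ (- gamma)) `^ (p - 1 - m) < b / 2).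
  case: hk => [k0|[k0 _ pm]]; first by exists 1 => // k1; have := lt_trans k0 k1; rewrite ltxx.
  have E0 : 0 <= (Kn + Ks) * M `^ (p - 1 - m) by rewrite mulr_ge0 ?powR_ge0 ?addr_ge0.
  have al0 : 0 < gamma * (m - (p - 1)) by rewrite mulr_gt0 ?subr_gt0.
  have [r2 r20 h2] := powR_small E0 (divr_gt0 b0 (ltr0Sn R 1)) al0.
  exists r2 => // _ r r0 /(h2 r r0); rewrite powRM ?powR_ge0 ?(ltW M0)// -powRrM mulrA.
  by rewrite (_ : - gamma * (p - 1 - m) = gamma * (m - (p - 1))) //; ring.
pose rho := Num.min (1 / 2) (Num.min (r1 / 2) (r2 / 2)).
have rho0 : 0 < rho by rewrite /rho !lt_min !divr_gt0.
have rho1 : rho < r1.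
  have : rho <= r1 / 2 by rewrite /rho !ge_min lexx orbT.
  by move=> h; apply: le_lt_trans h _; lra.
have rho2 : rho < r2.
  have : rho <= r2 / 2 by rewrite /rho !ge_min lexx !orbT.
  by move=> h; apply: le_lt_trans h _; lra.
have rhoh : rho <= 1 / 2 by rewrite /rho ge_min lexx.
exists rho; split=> [//|//|d d0 dr]; cbv zeta; set c := M * rho `^ (- gamma).
have c0 : 0 < c by rewrite mulr_gt0 ?powR_gt0.
have Bsmall : B * rho `^ (- sigma) < b / 2 * (M `^ m * rho `^ (- m)).
  have -> : rho `^ (- sigma) = rho `^ (m - sigma) * rho `^ (- m).
    by rewrite -powR_add//; congr powR; ring.
  by rewrite !mulrA ltr_pM2r ?powR_gt0// hr1.
pose X := c `^ m * d `^ ((gamma - 1) * m).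
have X0 : 0 <= X by rewrite mulr_ge0 ?powR_ge0.
have mainE : theta * (c * gamma * d `^ (gamma - 1)) `^ m = b * X.
  rewrite (@powRM _ (c * gamma) _ m (mulr_ge0 (ltW c0) (ltW g0)) (powR_ge0 _ _)).
  by rewrite (@powRM _ c gamma m (ltW c0) (ltW g0)) -powRrM /b /X; ring.
have Xge : M `^ m * rho `^ (- m) <= X by exact: main_term_ge.
have rs1 : 1 <= rho `^ (- sigma).
  rewrite powRN invf_ge1 ?powR_gt0// -(powR1l sigma).
  by apply: powR_le; [exact: ltW|exact: ltW|lra].
have near_le := near_term_le sigma p1 g01 c0 d0 Kn0.
have ckappa : c `^ (p - 1) * rho `^ kappa = Mp * rho `^ (- sigma).
  rewrite /c (powRM _ (ltW M0) (powR_ge0 _ _)) -powRrM -mulrA -powR_add//.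
  by congr (_ * _ `^ _); rewrite /kappa; ring.
rewrite mainE; set N := (_ `^ (p - 1) * (Kn * _)) in near_le *.
have rest : K0 + 2 `^ (p - 1) * (Mp * (Kf * rho `^ (- sigma)) + T) <=
    B * rho `^ (- sigma) - (Kn * Mp * rho `^ (- sigma) + Ks * Mp * rho `^ (- sigma)).
  have h1 : K0 <= K0 * rho `^ (- sigma) by rewrite ler_peMr.
  have h2 : T <= T * rho `^ (- sigma) by rewrite ler_peMr.
  have h3 : 2 `^ (p - 1) * (Mp * (Kf * rho `^ (- sigma)) + T) <=
      2 `^ (p - 1) * (Mp * (Kf * rho `^ (- sigma)) + T * rho `^ (- sigma)).
    by rewrite ler_wpM2l// lerD2l.
  apply: le_trans (lerD h1 h3) _.
  by rewrite le_eqVlt; apply/orP; left; apply/eqP; rewrite /B; ring.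
rewrite -/Mp.
have half : b / 2 * (M `^ m * rho `^ (- m)) <= b / 2 * X.
  by rewrite ler_pM2l ?divr_gt0.
have bX : b * X = b / 2 * X + b / 2 * X by rewrite -mulrDl -splitr.
case: hk => [k0|[k0 gk pm]].
  rewrite /annulus_bound k0.
  have dk : d `^ kappa <= rho `^ kappa by apply: powR_le; exact: ltW.
  have N1 : N <= Kn * Mp * rho `^ (- sigma).
    apply: le_trans near_le _; rewrite -/kappa -mulrA -ckappa mulrCA.
    by rewrite ler_wpM2l// ler_pM2l ?powR_gt0.
  have N2 : c `^ (p - 1) * (Ks * rho `^ kappa) = Ks * Mp * rho `^ (- sigma).
    by rewrite mulrCA ckappa mulrA.
  rewrite N2 bX; apply: (absorb_positive N1 rest Bsmall half).
  by rewrite lerDl mulr_ge0// divr_ge0// ltW.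
have -> : annulus_bound Ks kappa rho d = Ks * d `^ kappa.
  by rewrite /annulus_bound ifN// -leNgt ltW.
have d1 : d <= 1.
  by apply: ltW; apply: (lt_le_trans dr); apply: (le_trans rhoh); rewrite ler_pdivrMr// mul1r ler1n.
have dk : d `^ kappa <= d `^ ((gamma - 1) * m).
  have -> : d `^ kappa = d `^ ((gamma - 1) * m) * d `^ (kappa - (gamma - 1) * m).
    by rewrite -powR_add// addrC subrK.
  rewrite ger_pMr ?powR_gt0//; apply: le_trans (_ : _ <= 1 `^ (kappa - (gamma - 1) * m)) _; last by rewrite powR1l.
  by apply: powR_le; [rewrite subr_ge0|exact: ltW|].
have N3 : N + c `^ (p - 1) * (Ks * d `^ kappa) <= b / 2 * X.
  apply: (@le_trans _ _ ((Kn + Ks) * c `^ (p - 1) * d `^ ((gamma - 1) * m))).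
    apply: (@le_trans _ _ ((Kn + Ks) * c `^ (p - 1) * d `^ kappa)).
      have -> : (Kn + Ks) * c `^ (p - 1) * d `^ kappa =
          c `^ (p - 1) * (Kn * d `^ kappa) + c `^ (p - 1) * (Ks * d `^ kappa) by ring.
      by rewrite lerD2r.
    by rewrite ler_wpM2l// mulr_ge0 ?addr_ge0 ?powR_ge0.
  have -> : c `^ (p - 1) = c `^ (p - 1 - m) * c `^ m.
    by rewrite -powR_add//; congr powR; ring.
  have -> : (Kn + Ks) * (c `^ (p - 1 - m) * c `^ m) * d `^ ((gamma - 1) * m) =
      (Kn + Ks) * c `^ (p - 1 - m) * X by rewrite /X; ring.
  by rewrite ler_wpM2r//; apply: ltW; exact: hr2.
rewrite bX; apply: (absorb_negative N3 rest _ _ Bsmall half).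
- by rewrite !mulr_ge0 ?powR_ge0.
- by rewrite !mulr_ge0 ?powR_ge0.
Qed.

End scale_choice.

Section annulus_integral.
Context {R : realType} {n : nat}.
Local Notation L := (lebesgue_type R n).
Local Notation mu := (lebesgue_rV R n).

Definition annulus_const (a : R) : R :=
  shell_const (n := n) a / (1 - (if 0 < a then 2^-1 else 2) `^ a).

Lemma annulus_const_ge0 a : a != 0 -> 0 <= annulus_const a.
Proof.
move=> a0; rewrite divr_ge0 ?shell_const_ge0// subr_ge0 ltW//; case: ifPn => [a1|].
  by apply: powR_lt1 => //; rewrite invr_ge0 ler0n invf_lt1// ltr1n.
by rewrite -leNgt le_eqVlt (negbTE a0) => /powR2_lt1.
Qed.

Lemma integral_powR_annulus (a d rho : R) : a != 0 -> 0 < d -> d < rho ->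
  (\int[mu]_(z in [set z : L | (d <= enorm z < rho)%R]) (enorm z `^ (a - n%:R))%:E <=
   (annulus_bound (annulus_const a) a rho d)%:E)%E.
Proof.
move=> an0 d0 dr; have mk : measurable_fun [set: L] (fun z : L => (enorm z `^ (a - n%:R))%:E).
  by apply/measurable_EFinP; exact: measurable_powR_enorm.
have mD := @measurable_enorm_co R n d rho.
rewrite /annulus_bound /annulus_const; case: ifPn => a0.
  apply: le_trans (integral_powR_in (lt_trans d0 dr) a0).
  apply: (ge0_subset_integral mu mD (@measurable_annulus R n 0 rho)).
  - exact: measurable_funTS mk.
  - by move=> z _; rewrite lee_fin powR_ge0.
  - by move=> z /= /andP[dz ->]; rewrite andbT (lt_le_trans d0).
have an : a < 0 by rewrite lt_neqAle an0 leNgt.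
apply: le_trans (integral_powR_out d0 an).
apply: (ge0_subset_integral mu mD (@measurable_enorm_ge R n d)).
- exact: measurable_funTS mk.
- by move=> z _; rewrite lee_fin powR_ge0.
- by move=> z /= /andP[].
Qed.

End annulus_integral.

(* The logarithmic case [gamma * (p - 1) = s * p] is excluded; when the theorem
   asks for such a [gamma], a larger one is used. *)
Definition admissible_exponent (R : realType) (s p m gamma : R) :=
  0 < gamma * (p - 1) - s * p \/
  [/\ gamma * (p - 1) - s * p < 0, (gamma - 1) * m <= gamma * (p - 1) - s * p & p - 1 < m].

Lemma uniform_hoelder (R : realType) (n : nat) (s p m theta theta1 D gamma a : R) :
  0 < s < 1 -> 1 < p -> s * p < m -> 0 < theta -> 0 < theta1 -> 0 < D ->
  0 < gamma <= 1 -> admissible_exponent s p m gamma -> 0 <= a ->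
  exists2 c : R, 0 < c & forall (H : 'rV[R]_n -> 'rV[R]_n -> R) (u : 'rV[R]_n -> R),
    (forall x xi, theta * enorm xi `^ m - theta1 <= H x xi) ->
    measurable_fun [set: lebesgue_type R n] (u : lebesgue_type R n -> R) ->
    viscosity_subsolution s p H (fun=> D) (eball 0 2) u ->
    (forall x, eball 0 2 x -> `|u x| <= a) ->
    (\int[lebesgue_rV R n]_(z in [set z | (2 <= enorm z)%R])
      (`|u z| `^ (p - 1) / enorm z `^ (n%:R + s * p))%:E <= (a `^ (p - 1))%:E)%E ->
    forall x y, enorm x <= 1 -> enorm y <= 1 ->
      `|u x - u y| <= c * enorm (x - y) `^ gamma.
Proof.
move=> s01 p1 spm th0 th1 D0 g01 adm a0.
have /andP[s0 s1] := s01.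
have sp0 : 0 < s * p by rewrite mulr_gt0// (lt_trans _ p1).
have spp : s * p < p by rewrite gtr_pMl// (lt_trans _ p1).
set kappa := gamma * (p - 1) - s * p.
have kn0 : kappa != 0 by case: adm => [/gt_eqF ->|[/lt_eqF ->]].
pose M := 2 * a + 1.
have aM : 2 * a < M by rewrite ltrDl.
have M0 : 0 < M by rewrite ltr_wpDl// mulr_ge0.
have K00 : 0 <= D + theta1 by rewrite addr_ge0// ltW.
have Kn0 := @near_const_ge0 R n p (s * p) spp.
have Ks0 := @annulus_const_ge0 R n kappa kn0.
have Kf0 : 0 <= shell_const (n := n) (- (s * p)) / (1 - 2 `^ (- (s * p))).
  by rewrite divr_ge0 ?shell_const_ge0// subr_ge0 ltW// powR2_lt1// oppr_lt0.
have T0 : 0 <= 4 `^ (n%:R + s * p) * a `^ (p - 1) by rewrite mulr_ge0 ?powR_ge0.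
have [rho [rho0 rhoh hrho]] :=
  exists_scale p1 sp0 spm th0 g01 M0 K00 Kn0 Ks0 Kf0 T0 adm.
pose c := M * rho `^ (- gamma).
have c0 : 0 < c by rewrite mulr_gt0 ?powR_gt0.
have cM : c * rho `^ gamma = M by rewrite /c powRN mulfVK// gt_eqF// powR_gt0.
exists c => // H u HH mu' usub ua uT.
have [usc _ _] := usub.
have one x y : enorm x <= 1 -> enorm y <= 1 -> u x - u y <= c * enorm (x - y) `^ gamma.
  move=> x1 y1; have x2 : eball 0 2 x by rewrite /eball /= subr0 (le_lt_trans x1)// ltr1n.
  apply: (one_sided_hoelder usc ua y1 g01 rho0 rhoh c0 aM cM _ x2) => z z0 zr touch.
  have hS := @integral_powR_annulus R n _ _ _ kn0 z0 zr.
  have := touching_ineq s01 p1 HH usub mu' ua uT y1 g01 c0 (ltW aM) rhoh z0 zr touch hS.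
  by rewrite leNgt => /negP; apply; exact: (hrho _ z0 zr).
move=> x y x1 y1; rewrite ler_norml one// andbT lerNl opprB enorm_subC one//.
Qed.

Lemma hoelder_exponent_admissible (R : realType) (s p m gamma : R) :
  0 < s < 1 -> 1 < p -> s * p < m -> hoelder_exponent s p m gamma ->
  0 < gamma <= 1 /\
  exists g : R, [/\ gamma <= g, 0 < g <= 1 & admissible_exponent s p m g].
Proof.
move=> /andP[s0 s1] p1 spm; have p0 : 0 < p - 1 by rewrite subr_gt0.
have sp0 : 0 < s * p by rewrite mulr_gt0// (lt_trans _ p1).
case=> [[psp gE]|[[spE|/andP[sp1 mp]] g01]|[/andP[spp pm] ->]].
- have m0 : 0 < m - (p - 1) by rewrite subr_gt0 (lt_trans psp).
  have h : gamma * (m - (p - 1)) = m - s * p by rewrite gE mulfVK// gt_eqF.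
  have g0 : 0 < gamma by rewrite gE divr_gt0// subr_gt0.
  have g1 : gamma < 1 by rewrite gE ltr_pdivrMr// mul1r; lra.
  have kE : gamma * (p - 1) - s * p = (gamma - 1) * m by lra.
  have k0 : (gamma - 1) * m < 0 by rewrite pmulr_llt0 ?subr_lt0// (lt_trans sp0).
  rewrite g0 ltW//; split=> //; exists gamma; split; rewrite ?g0 ?(ltW g1)//.
  by right; rewrite kE; split=> //; rewrite (lt_trans psp).
- case/andP: g01 => g0 g1; rewrite spE in spm.
  rewrite g0 ltW//; split=> //; exists gamma; split; rewrite ?g0 ?(ltW g1)//.
  right; have kE : gamma * (p - 1) - s * p = (gamma - 1) * (p - 1) by rewrite spE; ring.
  rewrite kE; split=> //; first by rewrite pmulr_llt0 ?subr_lt0.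
  by rewrite ler_nM2l ?subr_lt0// ltW.
- case/andP: g01 => g0 g1; rewrite g0 ltW//; split=> //.
  pose q := (1 + s * p / (p - 1)) / 2.
  have tp : s * p / (p - 1) < 1 by rewrite ltr_pdivrMr// mul1r (lt_le_trans sp1).
  have t0 : 0 < s * p / (p - 1) by rewrite divr_gt0.
  have q1 : q <= 1 by rewrite /q; lra.
  have qk : s * p / (p - 1) < q by rewrite /q; lra.
  exists (Num.max gamma q); split; first by rewrite le_max lexx.
    by rewrite lt_max g0 ge_max (ltW g1).
  by left; rewrite subr_gt0 -ltr_pdivrMr// lt_max qk orbT.
- rewrite ltr01 lexx; split=> //; exists 1; rewrite ltr01 lexx; split=> //.
  by left; rewrite mul1r subr_gt0.
Qed.

Lemma powR_le_smaller_exponent (R : realType) (t g gamma : R) : 0 <= t <= 2 ->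
  0 < gamma -> gamma <= g -> g <= 1 -> t `^ g <= 2 * t `^ gamma.
Proof.
move=> /andP[t0 t2] g0 gg g1; have [->|tn0] := eqVneq t 0.
  by rewrite !powR0 ?gt_eqF ?(lt_le_trans g0)// mulr0.
have tp : 0 < t by rewrite lt_neqAle eq_sym tn0.
have -> : t `^ g = t `^ (g - gamma) * t `^ gamma by rewrite -powR_add// subrK.
rewrite ler_pM2r ?powR_gt0//; have d0 : 0 <= g - gamma by rewrite subr_ge0.
apply: le_trans (powR_le d0 t0 t2) _.
have e1 : 1 <= (2 : R) by rewrite ler1n.
have := @ler_powR R 2 e1 (g - gamma) 1; rewrite powRr1 ?ler0n//; apply; lra.
Qed.

Theorem theorem1p1 (R : realType) (n : nat) (s p m theta theta1 D gamma : R)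
    (A : \bar R) :
  (2 <= n)%N -> 0 < s < 1 -> 1 < p -> s * p < m ->
  0 < theta -> 0 < theta1 -> 0 < D -> hoelder_exponent s p m gamma ->
  exists C : R, forall (H : 'rV[R]_n -> 'rV[R]_n -> R) (u : 'rV[R]_n -> R),
    continuous (fun xxi : 'rV[R]_n * 'rV[R]_n => H xxi.1 xxi.2) ->
    (forall x xi, theta * enorm xi `^ m - theta1 <= H x xi) ->
    (u \_ (ecball 0 2)) \in Lfun (lebesgue_rV R n) +oo%E ->
    tail_space s p u ->
    viscosity_subsolution s p H (fun=> D) (eball 0 2) u ->
    A = (ereal_sup [set `|u x|%:E | x in eball 0 2] + Tail s p u 0 2)%E ->
    hoelder_in gamma (eball 0 1) u /\
    (hoelder_norm gamma (ecball 0 1) u <= C%:E)%E.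
Proof.
move=> _ s01 p1 spm th0 th1 D0 hg; have /andP[s0 _] := s01.
have sp0 : 0 < s * p by rewrite mulr_gt0// (lt_trans _ p1).
have [/andP[g0 _] [g [gg /andP[_ g1] adm]]] := hoelder_exponent_admissible s01 p1 spm hg.
have gb : 0 < g <= 1 by rewrite (lt_le_trans g0).
pose a := Num.max 0 (fine A); have a0 : 0 <= a by rewrite le_max lexx.
have [c c0 hc] := uniform_hoelder n s01 p1 spm th0 th1 D0 gb adm a0.
exists (a + c * 2) => H u _ HH uL ts usub AE; have [usc _ _] := usub.
have [b [Ab b0 ub uT]] := sup_tail_bounds sp0 p1 usc uL ts AE.
have ab : a = b by rewrite /a Ab; apply/max_idPr.
rewrite -ab in ub uT; have [umeas _ _] := ts.
have hol x y : ecball 0 1 x -> ecball 0 1 y -> `|u x - u y| <= c * 2 * enorm (x - y) `^ gamma.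
  rewrite /ecball /= !subr0 => x1 y1.
  apply: le_trans (hc H u HH umeas usub ub uT x y x1 y1) _; rewrite -mulrA ler_pM2l//.
  have xy2 : enorm (x - y) <= 2.
    by have := ler_enormD x (- y); rewrite enormN => h; apply: le_trans h (lerD x1 y1).
  by apply: powR_le_smaller_exponent => //; rewrite enorm_ge0.
split; first by exists (c * 2) => x y /ltW x1 /ltW y1; exact: hol.
rewrite EFinD; apply: leeD.
  apply: ge_ereal_sup => _ [x x1 <-]; rewrite lee_fin; apply: ub; move: x1.
  by rewrite /ecball /eball /= subr0 => x1; rewrite (le_lt_trans x1)// ltr1n.
apply: ge_ereal_sup => _ [[x y] /= [x1 y1 xy] <-].
rewrite lee_fin ler_pdivrMr; first exact: hol.
by rewrite powR_gt0// enorm_gt0 subr_eq0.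
Qed.
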